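(* Let $k$ be a field, let $\mathcal{C}$ be a formation of algebraic groups over $k$ and let $\Gamma$ and $\Gamma'$ be saturated pro-$\mathcal{C}$-groups with $\operatorname{rank}(\Gamma)=\operatorname{rank}(\Gamma')$. Then $\Gamma$ and $\Gamma'$ are isomorphic.
   Context: An algebraic group is an affine group scheme of finite type over $k$; a proalgebraic group is an affine group scheme over $k$. Closed subgroup means closed subgroup scheme. A morphism $G\to H$ of proalgebraic groups is an epimorphism ($G\twoheadrightarrow H$) if the dual map $k[H]\to k[G]$ on coordinate rings is injective (equivalently, it identifies $H$ with a quotient $G/N$ by a normal closed subgroup $N$). A normal closed subgroup $N$ of $G$ is coalgebraic if $G/N$ is algebraic. A formation $\mathcal{C}$ is a non-empty class of algebraic groups over $k$, closed under isomorphism and containing a non-trivial group, such that (a) every quotient of a group in $\mathcal{C}$ is in $\mathcal{C}$; (b) if $G_1,G_2\in\mathcal{C}$ and $H\leq G_1\times G_2$ is a closed subgroup such that both projections $H\to G_i$ are epimorphisms, then $H\in\mathcal{C}$. A pro-$\mathcal{C}$-group is a proalgebraic group that is a projective limit (over a directed set) of groups in $\mathcal{C}$ with transition maps epimorphisms. A neighborhood basis at $1$ for $G$ is a set $\mathcal{N}$ of coalgebraic subgroups such that every coalgebraic subgroup of $G$ contains some member of $\mathcal{N}$. The rank of a non-trivial proalgebraic group $G$ is the smallest cardinality of a neighborhood basis at $1$ for $G$; the trivial group has rank $0$. A pro-$\mathcal{C}$-group $\Gamma$ of infinite rank is saturated if for all epimorphisms $\alpha\colon G\twoheadrightarrow H$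 and $\beta\colon\Gamma\twoheadrightarrow H$ of pro-$\mathcal{C}$-groups with $\operatorname{rank}(H)<\operatorname{rank}(\Gamma)$ and $\operatorname{rank}(G)\leq\operatorname{rank}(\Gamma)$ there is an epimorphism $\phi\colon\Gamma\twoheadrightarrow G$ with $\alpha\phi=\beta$. *)

(* Defs.v *)
From HB Require Import structures.
From mathcomp Require Import all_boot all_order all_algebra.
From mathcomp Require Import boolp classical_sets functions cardinality.

Set Implicit Arguments.
Unset Strict Implicit.
Unset Printing Implicit Defensive.

Import GRing.Theory.
Local Open Scope ring_scope.
Local Open Scope classical_set_scope.
Local Open Scope card_scope.

(* An affine scheme over k is given by its coordinate ring A, its R-points
   being the k-algebra morphisms A -> R.  Under boolp's axioms two such
   morphisms are equal as soon as they agree pointwise (lemma lrmorph_ext), so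
   Leibniz equality of points is the usual one.

   A comAlgType is a non-zero commutative k-algebra.  Leaving out R = 0 loses
   nothing, as a k-algebra has exactly one point there; and the coordinate ring
   of a group scheme is never zero, since it has a counit. *)
Lemma lrmorph_ext (k : fieldType) (A R : comAlgType k)
  (x y : {lrmorphism A -> R}) : x =1 y -> x = y.
Proof.
case: x y => [x [[mx] [ax] [sx]]] [y [[my] [ay] [sy]]] /= /funext exy.
subst y.
by rewrite (Prop_irrelevance mx my) (Prop_irrelevance ax ay)
  (Prop_irrelevance sx sy).
Qed.

(* A proalgebraic group over k, i.e. an affine group scheme: a representable
   functor R |-> {lrmorphism coordring -> R} with a natural group structure. *)
Record progroup (k : fieldType) := ProGroup {
  coordring : comAlgType k;
  pone : forall R : comAlgType k, {lrmorphism coordring -> R};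
  pinv : forall R : comAlgType k,
    {lrmorphism coordring -> R} -> {lrmorphism coordring -> R};
  pmul : forall R : comAlgType k,
    {lrmorphism coordring -> R} -> {lrmorphism coordring -> R} ->
    {lrmorphism coordring -> R};
  pmulA : forall (R : comAlgType k) (x y z : {lrmorphism coordring -> R}),
    pmul x (pmul y z) = pmul (pmul x y) z;
  pmul1g : forall (R : comAlgType k) (x : {lrmorphism coordring -> R}), pmul (pone R) x = x;
  pmulVg : forall (R : comAlgType k) (x : {lrmorphism coordring -> R}),
    pmul (pinv x) x = pone R;
  pmul_nat : forall (R S : comAlgType k) (f : {lrmorphism R -> S})
    (x y : {lrmorphism coordring -> R}),
    (f \o pmul x y : {lrmorphism coordring -> S}) = pmul (f \o x) (f \o y) }.

Arguments pone {k} p R.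

Notation pt G R := {lrmorphism coordring G -> R}.

Section Groups.
Variable k : fieldType.
Implicit Types (G H K N P : progroup k) (R : comAlgType k).

Definition comap_pt G H (c : {lrmorphism coordring H -> coordring G}) R (x : pt G R) :
  pt H R := x \o c.

Record pghom G H := Hom {
  comap : {lrmorphism coordring H -> coordring G};
  comapM : forall R (x y : pt G R),
    comap_pt comap (pmul x y) = pmul (comap_pt comap x) (comap_pt comap y) }.

Definition map_pt G H (f : pghom G H) R (x : pt G R) : pt H R :=
  comap_pt (comap f) x.

Definition hom_eq G H (f g : pghom G H) := comap f =1 comap g.

Lemma id_homM G R (x y : pt G R) :
  comap_pt (idfun : {lrmorphism coordring G -> coordring G}) (pmul x y) =
  pmul (comap_pt idfun x) (comap_pt idfun y).
Proof.
by rewrite /comap_pt; apply: lrmorph_ext => a /=; congr (pmul _ _ _);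
  apply: lrmorph_ext.
Qed.

Definition id_hom G : pghom G G := Hom (@id_homM G).

Lemma comp_homM G H K (g : pghom H K) (f : pghom G H) R (x y : pt G R) :
  comap_pt (comap f \o comap g : {lrmorphism coordring K -> coordring G}) (pmul x y) =
  pmul (comap_pt (comap f \o comap g) x) (comap_pt (comap f \o comap g) y).
Proof.
have E (z : pt G R) : comap_pt (comap f \o comap g) z = map_pt g (map_pt f z).
  exact: lrmorph_ext.
by rewrite !E /map_pt !comapM.
Qed.

(* g after f *)
Definition comp_hom G H K (g : pghom H K) (f : pghom G H) : pghom G K :=
  Hom (comp_homM g f).

Definition epi G H (f : pghom G H) : Prop := injective (comap f).

Definition closed_immersion G H (f : pghom G H) : Prop :=
  forall a : coordring G, exists b : coordring H, comap f b = a.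

Definition isomorphic G H : Prop :=
  exists (f : pghom G H) (g : pghom H G),
    hom_eq (comp_hom g f) (id_hom G) /\ hom_eq (comp_hom f g) (id_hom H).

Definition trivial_group G : Prop := forall R (x : pt G R), x = pone G R.

Definition subalgebra (A : comAlgType k) (B : set A) : Prop :=
  [/\ B 1, (forall c u v, B u -> B v -> B (c *: u + v))
     & (forall u v, B u -> B v -> B (u * v))].

Definition finitely_generated (A : comAlgType k) : Prop :=
  exists s : seq A, forall B : set A,
    subalgebra B -> (forall a, a \in s -> B a) -> B = setT.

Definition algebraic G : Prop := finitely_generated (coordring G).

(* Closed subschemes of G are ideals of its coordinate ring; an R-point lies in
   the subscheme when it vanishes on the ideal.  The bijection between ideals
   and closed subschemes reverses inclusions. *)
Definition ideal (A : comAlgType k) (I : set A) : Prop :=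
  [/\ I 0, (forall a b, I a -> I b -> I (a + b))
     & (forall a b, I b -> I (a * b))].

Definition in_closed G (I : set (coordring G)) R (x : pt G R) : Prop :=
  forall a, I a -> x a = 0.

Definition closed_subgroup G (I : set (coordring G)) : Prop :=
  ideal I /\
  forall R,
    [/\ in_closed I (pone G R),
        (forall x y : pt G R,
           in_closed I x -> in_closed I y -> in_closed I (pmul x y))
      & (forall x : pt G R, in_closed I x -> in_closed I (pinv x))].
Arguments closed_subgroup G : clear implicits.

Definition normal_subgroup G (I : set (coordring G)) : Prop :=
  closed_subgroup G I /\
  forall R (x y : pt G R),
    in_closed I x -> in_closed I (pmul (pmul y x) (pinv y)).
Arguments normal_subgroup G : clear implicits.

Definition is_quotient G (I : set (coordring G)) Q (f : pghom G Q) : Prop :=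
  epi f /\ forall R (x : pt G R), in_closed I x <-> map_pt f x = pone Q R.

Definition coalgebraic G (I : set (coordring G)) : Prop :=
  normal_subgroup G I /\
  exists (Q : progroup k) (f : pghom G Q), is_quotient I f /\ algebraic Q.
Arguments coalgebraic G : clear implicits.

Definition subgroup_contains G (I J : set (coordring G)) : Prop := I `<=` J.

Definition nbhd_basis G (B : set (set (coordring G))) : Prop :=
  B `<=` coalgebraic G /\
  forall I, coalgebraic G I -> exists2 J, B J & subgroup_contains I J.
Arguments nbhd_basis G : clear implicits.

Definition minimal_nbhd_basis G (B : set (set (coordring G))) : Prop :=
  nbhd_basis G B /\ forall B', nbhd_basis G B' -> B #<= B'.
Arguments minimal_nbhd_basis G : clear implicits.

(* The rank of G is the cardinality of the set [rank G]: a chosen neighbourhood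
   basis of smallest cardinality, or the empty set if G is trivial.  Ranks are
   only to be compared through #= and #<=. *)
Definition rank G : set (set (coordring G)) :=
  if `[< trivial_group G >] then set0
  else xget set0 (minimal_nbhd_basis G).
Arguments rank G : clear implicits.

Definition rank_eq G H : Prop := rank G #= rank H.
Definition rank_le G H : Prop := rank G #<= rank H.
Definition rank_lt G H : Prop := rank_le G H /\ ~ rank_eq G H.

Definition is_product P G1 G2 (p1 : pghom P G1) (p2 : pghom P G2) : Prop :=
  forall R (x1 : pt G1 R) (x2 : pt G2 R),
    exists! x : pt P R, map_pt p1 x = x1 /\ map_pt p2 x = x2.

(* Closed subgroups of a product G1 x G2 appear here as groups H with a closed
   immersion into it; this is harmless as the class is isomorphism-closed. *)
Record formation (C : progroup k -> Prop) : Prop := Formation {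
  formation_algebraic : forall G, C G -> algebraic G;
  formation_iso : forall G H, isomorphic G H -> C G -> C H;
  formation_nontrivial : exists2 G, C G & ~ trivial_group G;
  formation_quotient : forall G Q (f : pghom G Q), epi f -> C G -> C Q;
  formation_subdirect : forall G1 G2 P (p1 : pghom P G1) (p2 : pghom P G2) H
    (i : pghom H P),
    C G1 -> C G2 -> is_product p1 p2 -> closed_immersion i ->
    epi (comp_hom p1 i) -> epi (comp_hom p2 i) -> C H }.

Definition directed (I : Type) (le : I -> I -> Prop) : Prop :=
  [/\ inhabited I, (forall i, le i i),
      (forall i j l, le i j -> le j l -> le i l)
    & (forall i j, exists2 l, le i l & le j l)].

Definition projective_system (I : Type) (le : I -> I -> Prop)
    (X : I -> progroup k) (t : forall i j, le i j -> pghom (X j) (X i)) : Prop :=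
  (forall i (h : le i i), hom_eq (t i i h) (id_hom (X i))) /\
  (forall i j l (hij : le i j) (hjl : le j l) (hil : le i l),
     hom_eq (t i l hil) (comp_hom (t i j hij) (t j l hjl))).

Definition projective_limit (I : Type) (le : I -> I -> Prop)
    (X : I -> progroup k) (t : forall i j, le i j -> pghom (X j) (X i))
    G (p : forall i, pghom G (X i)) : Prop :=
  (forall i j (h : le i j), hom_eq (comp_hom (t i j h) (p j)) (p i)) /\
  forall R (x : forall i, pt (X i) R),
    (forall i j (h : le i j), map_pt (t i j h) (x j) = x i) ->
    exists! y : pt G R, forall i, map_pt (p i) y = x i.

Definition pro (C : progroup k -> Prop) G : Prop :=
  exists (I : Type) (le : I -> I -> Prop) (X : I -> progroup k)
    (t : forall i j, le i j -> pghom (X j) (X i)) (p : forall i, pghom G (X i)),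
    [/\ directed le, (forall i, C (X i)), projective_system t,
        (forall i j (h : le i j), epi (t i j h)) & projective_limit t p].

Definition saturated (C : progroup k -> Prop) (Gamma : progroup k) : Prop :=
  [/\ pro C Gamma, infinite_set (rank Gamma) &
    forall G H (alpha : pghom G H) (beta : pghom Gamma H),
      pro C G -> pro C H -> epi alpha -> epi beta ->
      rank_lt H Gamma -> rank_le G Gamma ->
      exists phi : pghom Gamma G, epi phi /\ hom_eq (comp_hom alpha phi) beta].

End Groups.

Arguments closed_subgroup {k} G.
Arguments normal_subgroup {k} G.
Arguments coalgebraic {k} G.
Arguments nbhd_basis {k} G.
Arguments minimal_nbhd_basis {k} G.
Arguments rank {k} G.

(* Main.v *)
From HB Require Import structures.
From mathcomp Require Import all_boot all_order all_algebra.
From mathcomp Require wochoice.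
From mathcomp Require Import boolp classical_sets functions cardinality.
Require Import Defs.

(** The coordinate rings of the two groups are compared by a transfinite
    back-and-forth argument, in which the rank enters as the number of steps.

    A common quotient of Gamma and Gamma' is a group H with epimorphisms from
    both; it is recorded by its graph, the set of pairs of functions on Gamma
    and Gamma' that come from the same function on H.  Graphs are characterised
    intrinsically ([hopf_relation], [hopf_relation_graph]), so that the union of
    a chain of them is again one ([bigcup_common_quotient]), and this deals with
    limit steps.  At a successor step, H has to grow so that its ring contains
    prescribed functions on Gamma: as Gamma is pro-C, some quotient X of Gamma in
    C already has them in its ring; let K be the quotient of Gamma whose ring is
    generated by those of H and X.  Saturation of Gamma', applied to K ->> H and
    Gamma' ->> H, lifts K to a common quotient ([extend_left]).  Exchanging the
    two groups does the same for prescribed functions on Gamma'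
    ([extend_common_quotient]).

    The steps are indexed by an initial well-order of the cardinal rank(Gamma), so
    that fewer than rank(Gamma) steps precede any given one.  Each of them adds
    finitely many generators to the ring of H; a group generated by a set of
    cardinality d of finite lists of functions has rank at most d if d is
    infinite, and a finite rank if d is finite ([rank_bound]).  So rank(H) stays
    below rank(Gamma) and saturation applies at every step.

    Each element N of a minimal neighbourhood basis of Gamma, or of Gamma', is
    handled at some step, where generators of the ring of Gamma/N, or Gamma'/N,
    are put into that of H.  In the end Gamma ->> H and Gamma' ->> H have trivial
    kernel, and they are isomorphisms ([basis_surjective],
    [bijective_isomorphic]).

    The last implication is the theorem that an epimorphism with trivial kernel is
    an isomorphism ([trivial_kernel_surjective]).  Let B be a Hopf subalgebra of A
    such that the kernel of Spec A -> Spec B is trivial.  Then two points of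
    Spec A that agree on B are equal, so a (x) 1 - 1 (x) a is in the ideal
    of A (x) A generated by the differences b (x) 1 - 1 (x) b.  A nonzero B-linear
    functional on a suitable finitely generated B-submodule of A, obtained from
    minors of a matrix of relations, turns this into a nonzero b in B with b a in B
    ([common_denominator]).  The ideal of those b that serve for all translates
    of a at once is stable under translations, and a nonzero ideal of B with this
    property contains 1 ([conductor_full]); hence a is in B.

    Groups are given by their functors of points, so coproducts are obtained from
    tensor products of algebras, and identities between coproducts are transferred
    to arbitrary multilinear maps through universal points
    ([bilinear_detection], [trilinear_detection]). *)

Set Implicit Arguments.
Unset Strict Implicit.
Unset Printing Implicit Defensive.

Import GRing.Theory.
Local Open Scope ring_scope.
Local Open Scope classical_set_scope.
Local Open Scope card_scope.

(** * Commutative algebras as quotients of raw structures *)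

(** Raw operations that satisfy the axioms of a commutative algebra only up to
    the equivalence [peq].  Tensor products, quotients, subalgebras and reduced
    products are all built from instances of this record, whose axioms can be
    checked on representatives. *)
Record prealg (k : fieldType) := Prealg {
  pcar :> Type;
  pzero : pcar;
  punit : pcar;
  padd : pcar -> pcar -> pcar;
  popp : pcar -> pcar;
  ptimes : pcar -> pcar -> pcar;
  pscale : k -> pcar -> pcar;
  peq : pcar -> pcar -> Prop;
  peq_refl : forall a, peq a a;
  peq_sym : forall a b, peq a b -> peq b a;
  peq_trans : forall a b c, peq a b -> peq b c -> peq a c;
  paddE : forall a a' b b', peq a a' -> peq b b' -> peq (padd a b) (padd a' b');
  poppE : forall a a', peq a a' -> peq (popp a) (popp a');
  ptimesE : forall a a' b b', peq a a' -> peq b b' -> peq (ptimes a b) (ptimes a' b');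
  pscaleE : forall c a a', peq a a' -> peq (pscale c a) (pscale c a');
  paddA : forall a b c, peq (padd a (padd b c)) (padd (padd a b) c);
  paddC : forall a b, peq (padd a b) (padd b a);
  padd0 : forall a, peq (padd pzero a) a;
  paddN : forall a, peq (padd (popp a) a) pzero;
  ptimesA : forall a b c, peq (ptimes a (ptimes b c)) (ptimes (ptimes a b) c);
  ptimesC : forall a b, peq (ptimes a b) (ptimes b a);
  ptimes1 : forall a, peq (ptimes punit a) a;
  ptimesD : forall a b c, peq (ptimes (padd a b) c) (padd (ptimes a c) (ptimes b c));
  punit_neq0 : ~ peq punit pzero;
  pscaleA : forall c d a, peq (pscale c (pscale d a)) (pscale (c * d) a);
  pscale1 : forall a, peq (pscale 1 a) a;
  pscaleDr : forall c a b, peq (pscale c (padd a b)) (padd (pscale c a) (pscale c b));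
  pscaleDl : forall c d a, peq (pscale (c + d) a) (padd (pscale c a) (pscale d a));
  pscaleAl : forall c a b, peq (pscale c (ptimes a b)) (ptimes (pscale c a) b) }.

Section Quotient.
Variables (k : fieldType) (P : prealg k).

Definition qcar := {s : set P | exists t, s = peq t}.

Definition qpi (t : P) : qcar := exist _ (peq t) (ex_intro _ t erefl).
Definition qrep (s : qcar) : P := projT1 (cid (svalP s)).

Lemma qcar_inj (s t : qcar) : sval s = sval t -> s = t.
Proof.
by case: s t => s hs [t ht] /= E; subst t; congr exist; apply: Prop_irrelevance.
Qed.

Lemma qpi_eq t u : qpi t = qpi u <-> peq t u.
Proof.
split=> [[E]|tu]; first by rewrite E; apply: peq_refl.
apply: qcar_inj; apply/funext => v; apply/propext; split.
  by apply: peq_trans; apply: peq_sym.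
exact: peq_trans.
Qed.

Lemma qrepK s : qpi (qrep s) = s.
Proof. by apply: qcar_inj => /=; rewrite /qrep; case: cid. Qed.

Lemma peq_rep t : peq (qrep (qpi t)) t.
Proof. by apply/qpi_eq; rewrite qrepK. Qed.

Lemma qcarP (s : qcar) : exists t, s = qpi t.
Proof. by exists (qrep s); rewrite qrepK. Qed.

Definition qadd s t := qpi (padd (qrep s) (qrep t)).
Definition qopp s := qpi (popp (qrep s)).
Definition qmul s t := qpi (ptimes (qrep s) (qrep t)).
Definition qscale c s := qpi (pscale c (qrep s)).

Lemma qaddE a b : qadd (qpi a) (qpi b) = qpi (padd a b).
Proof. by apply/qpi_eq/paddE; apply: peq_rep. Qed.
Lemma qoppE a : qopp (qpi a) = qpi (popp a).
Proof. by apply/qpi_eq/poppE; apply: peq_rep. Qed.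
Lemma qmulE a b : qmul (qpi a) (qpi b) = qpi (ptimes a b).
Proof. by apply/qpi_eq/ptimesE; apply: peq_rep. Qed.
Lemma qscaleE c a : qscale c (qpi a) = qpi (pscale c a).
Proof. by apply/qpi_eq/pscaleE; apply: peq_rep. Qed.
Definition qE := (qaddE, qoppE, qmulE, qscaleE).

HB.instance Definition _ := gen_eqMixin qcar.
HB.instance Definition _ := gen_choiceMixin qcar.

Fact qaddA : associative qadd.
Proof.
by move=> s t u; have [a ->] := qcarP s; have [b ->] := qcarP t;
  have [c ->] := qcarP u; rewrite !qE; apply/qpi_eq/paddA.
Qed.
Fact qaddC : commutative qadd.
Proof.
by move=> s t; have [a ->] := qcarP s; have [b ->] := qcarP t;
  rewrite !qE; apply/qpi_eq/paddC.
Qed.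
Fact qadd0 : left_id (qpi (pzero P)) qadd.
Proof. by move=> s; have [a ->] := qcarP s; rewrite !qE; apply/qpi_eq/padd0. Qed.
Fact qaddN : left_inverse (qpi (pzero P)) qopp qadd.
Proof. by move=> s; have [a ->] := qcarP s; rewrite !qE; apply/qpi_eq/paddN. Qed.
HB.instance Definition _ := GRing.isZmodule.Build qcar qaddA qaddC qadd0 qaddN.

Fact qmulA : associative qmul.
Proof.
by move=> s t u; have [a ->] := qcarP s; have [b ->] := qcarP t;
  have [c ->] := qcarP u; rewrite !qE; apply/qpi_eq/ptimesA.
Qed.
Fact qmulC : commutative qmul.
Proof.
by move=> s t; have [a ->] := qcarP s; have [b ->] := qcarP t;
  rewrite !qE; apply/qpi_eq/ptimesC.
Qed.
Fact qmul1 : left_id (qpi (punit P)) qmul.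
Proof. by move=> s; have [a ->] := qcarP s; rewrite !qE; apply/qpi_eq/ptimes1. Qed.
Fact qmulD : left_distributive qmul +%R.
Proof.
move=> s t u; have [a ->] := qcarP s; have [b ->] := qcarP t.
by have [c ->] := qcarP u; rewrite /GRing.add /= !qE; apply/qpi_eq/ptimesD.
Qed.
Fact q1_neq0 : qpi (punit P) != 0.
Proof. by apply/eqP => /qpi_eq /punit_neq0. Qed.
HB.instance Definition _ :=
  GRing.Zmodule_isComNzRing.Build qcar qmulA qmulC qmul1 qmulD q1_neq0.

Fact qscaleA c d s : qscale c (qscale d s) = qscale (c * d) s.
Proof. by have [a ->] := qcarP s; rewrite !qE; apply/qpi_eq/pscaleA. Qed.
Fact qscale1 : left_id 1 qscale.
Proof. by move=> s; have [a ->] := qcarP s; rewrite !qE; apply/qpi_eq/pscale1. Qed.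
Fact qscaleDr : right_distributive qscale +%R.
Proof.
move=> c s t; have [a ->] := qcarP s; have [b ->] := qcarP t.
by rewrite /GRing.add /= !qE; apply/qpi_eq/pscaleDr.
Qed.
Fact qscaleDl s : {morph qscale^~ s : c d / c + d}.
Proof.
move=> c d; have [a ->] := qcarP s.
by rewrite /GRing.add /= !qE; apply/qpi_eq/pscaleDl.
Qed.
HB.instance Definition _ :=
  GRing.Zmodule_isLmodule.Build k qcar qscaleA qscale1 qscaleDr qscaleDl.

Fact qscaleAl c (s t : qcar) : c *: (s * t) = (c *: s) * t.
Proof.
have [a ->] := qcarP s; have [b ->] := qcarP t.
by rewrite /GRing.scale /GRing.mul /= !qE; apply/qpi_eq/pscaleAl.
Qed.
HB.instance Definition _ := GRing.Lmodule_isLalgebra.Build k qcar qscaleAl.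
HB.instance Definition _ := GRing.Lalgebra_isComAlgebra.Build k qcar.

Lemma prealg_quotient : exists (Q : comAlgType k) (pi : P -> Q),
  [/\ forall s, exists a, s = pi a, forall a b, pi a = pi b <-> peq a b,
      pi (punit P) = 1, (forall c a b, pi (padd (pscale c a) b) = c *: pi a + pi b)
    & (forall a b, pi (ptimes a b) = pi a * pi b)].
Proof.
exists qcar, qpi; split=> //; [exact: qcarP|exact: qpi_eq| |].
  by move=> c a b; rewrite /GRing.scale /GRing.add /= !qE.
by move=> a b; rewrite /GRing.mul /= !qE.
Qed.

End Quotient.

(** Algebra morphisms are mostly obtained by choosing values, so a plain function
    with the right properties has to be bundled afterwards. *)
Lemma lrmorphism_intro (k : fieldType) (A B : comAlgType k) (f : A -> B) :
  f 1 = 1 -> (forall c a b, f (c *: a + b) = c *: f a + f b) ->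
  (forall a b, f (a * b) = f a * f b) ->
  exists g : {lrmorphism A -> B}, g =1 f.
Proof.
move=> f1 fl fM.
pose l := GRing.isLinear.Build k A B *:%R f fl.
pose m := GRing.isMonoidMorphism.Build A B f (conj f1 fM).
pose g : {lrmorphism A -> B} := HB.pack f l m.
by exists g.
Qed.

(** * Extension of linear maps *)

Section LinearExtension.
Variables (k : fieldType) (V U : lmodType k).

Definition linear_graph (Z : set (V * U)) : Prop :=
  (forall c z w, Z z -> Z w -> Z (c *: z + w)) /\ (forall u, Z (0, u) -> u = 0).

(** By Zorn's lemma a linear graph that is single-valued at 0 has a maximal
    extension, and a maximal linear graph is defined everywhere, since a missing
    vector can be sent to 0.  Working with graphs spares a type for the subspace on
    which the map is given. *)
Lemma linear_extension (Z : set (V * U)) : Z 0 -> linear_graph Z ->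
  exists g : V -> U, linear g /\ forall z, Z z -> g z.1 = z.2.
Proof.
move=> Z0 Zlin.
have [X [Xlin Xmax]] : exists X, linear_graph (X `|` Z) /\
    forall Y, X `<` Y -> ~ linear_graph (Y `|` Z).
  apply: (Zorn_bigcup (P := fun X => linear_graph (X `|` Z))) => F FP Ftot.
  have two z w : (\bigcup_(X in F) X `|` Z) z -> (\bigcup_(X in F) X `|` Z) w ->
      exists Y, [/\ linear_graph Y, Y z, Y w & Y `<=` \bigcup_(X in F) X `|` Z].
    have sub X : F X -> X `|` Z `<=` \bigcup_(X in F) X `|` Z.
      by move=> FX v [Xv|Zv]; [left; exists X|right].
    case=> [[X1 F1 Xz]|Zz] [[X2 F2 Xw]|Zw].
    - have [le|le] := Ftot _ _ F1 F2.
        by exists (X2 `|` Z); split; [exact: FP|left; exact: le|left|exact: sub].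
      by exists (X1 `|` Z); split; [exact: FP|left|left; exact: le|exact: sub].
    - by exists (X1 `|` Z); split; [exact: FP|left|right|exact: sub].
    - by exists (X2 `|` Z); split; [exact: FP|right|left|exact: sub].
    - by exists Z; split=> // v Zv; right.
  split=> [c z w hz hw|u hu].
    have [Y [[Yl _] Yz Yw sub]] := two _ _ hz hw.
    exact/sub/Yl.
  by have [Y [[_ Y0] Yz _ _]] := two _ _ hu hu; apply: Y0.
set Y := X `|` Z in Xlin.
have Y0 : Y 0 by right.
case: (Xlin) => Yl Yf.
have Yu v u u' : Y (v, u) -> Y (v, u') -> u = u'.
  move=> h h'; apply/eqP; rewrite -subr_eq0; apply/eqP/Yf.
  have := Yl (-1) _ _ h' h.
  by rewrite /GRing.add /GRing.scale /= /add_pair /scale_pair /= !scaleN1r !(addrC (- _)) subrr.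
have Ytot v : exists u, Y (v, u).
  apply: contrapT => hv.
  (* Y extended by sending the missing vector v to 0 *)
  pose W := [set z : V * U | exists c y, Y y /\ z = c *: (v, 0) + y].
  have YW : Y `<=` W by move=> y hy; exists 0, y; rewrite scale0r add0r.
  have Wv : W (v, 0) by exists 1, 0; rewrite scale1r addr0.
  apply: (Xmax W).
    split; first by move=> y hy; apply: YW; left.
    by move=> sub; apply: hv; exists 0; left; apply: sub.
  suff -> : W `|` Z = W.
    split=> [c _ _ [d [y [hy ->]]] [e [x [hx ->]]]|u [c [[y1 y2] [hy [E ->]]]]].
      exists (c * d + e), (c *: y + x); split; first exact: Yl.
      by rewrite scalerDr scalerDl scalerA !addrA (addrAC (_ *: _)).
    have [c0|c0] := eqVneq c 0.
      move: E; rewrite c0 /= scale0r add0r => y10; subst y1.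
      by rewrite /= scaler0 add0r; apply: Yf.
    case: hv; exists (- (c^-1) *: y2).
    have := Yl (- c^-1) _ _ hy Y0; rewrite addr0.
    have -> : - c^-1 *: (y1, y2) = (v, - c^-1 *: y2) => //.
    congr pair; move/eqP: E => /=; rewrite addrC eq_sym addr_eq0 => /eqP ->.
    by rewrite scalerN scaleNr opprK scalerA mulVf // scale1r.
  by apply/seteqP; split=> [z [//|Zz]|z]; [apply: YW; right|left].
pose g v := projT1 (cid (Ytot v)).
have gP v : Y (v, g v) by rewrite /g; case: cid.
exists g; split=> [c u v|[v u] Zz /=]; last by apply: Yu (gP v) _; right.
apply: Yu (gP _) _.
exact: (Yl c _ _ (gP u) (gP v)).
Qed.

Lemma linear_left_inverse (f : U -> V) : linear f -> injective f ->
  exists g : V -> U, linear g /\ cancel f g.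
Proof.
move=> fl fi.
have f0 : f 0 = 0.
  by have := fl 1 0 0; rewrite !scale1r !addr0 -[LHS]addr0 => /addrI <-.
have [||g [gl gP]] := @linear_extension [set z | z.1 = f z.2].
- by rewrite /= f0.
- split=> [c z w /= hz hw|u /= E]; first by rewrite fl hz hw.
  by apply: fi; rewrite f0.
by exists g; split=> // u; rewrite (gP (f u, u)).
Qed.

End LinearExtension.

Lemma linear_functional (k : fieldType) (V : lmodType k) (W : set V) (v : V) :
  W 0 -> (forall c w w', W w -> W w' -> W (c *: w + w')) -> ~ W v ->
  exists f : V -> k, [/\ linear (f : V -> k^o), f v = 1 & forall w, W w -> f w = 0].
Proof.
move=> W0 Wl Wv.
have [||f [fl fP]] := @linear_extension k V k^o
    [set z | exists w, W w /\ z.1 = w + z.2 *: v].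
- by exists 0; rewrite scale0r addr0.
- split=> [c z w [a [ha Ea]] [b [hb Eb]]|u [w /= [hw E]]].
    exists (c *: a + b); split; first exact: Wl.
    by rewrite /= Ea Eb scalerDr scalerDl scalerA !addrA (addrAC (_ *: _)).
  apply: contrapT => /eqP u0; apply: Wv.
  have -> : v = - u^-1 *: w + 0; last exact: Wl.
  rewrite addr0; move/eqP: E; rewrite addrC eq_sym addr_eq0 => /eqP E.
  by rewrite scaleNr -scalerN -E scalerA mulVf // scale1r.
exists f; split=> // [|w hw]; first by rewrite (fP (v, 1)) //; exists 0; rewrite add0r scale1r.
by rewrite (fP (w, 0)) //; exists w; rewrite scale0r addr0.
Qed.

(** * Tensor products *)

Definition bilinear_map (k : fieldType) (V W U : lmodType k) (F : V -> W -> U) : Prop :=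
  (forall w, linear (F^~ w)) /\ (forall v, linear (F v)).

(** Linearity is used below for bare functions, such as those produced by
    [linear_extension], so the elementary consequences are restated for them. *)
Section LinearSums.
Variables (k : fieldType) (V U : lmodType k) (f : V -> U).
Hypothesis fl : linear f.

Lemma linear_0 : f 0 = 0.
Proof. by have := fl 1 0 0; rewrite !scale1r !addr0 -[LHS]addr0 => /addrI <-. Qed.

Lemma linear_D u v : f (u + v) = f u + f v.
Proof. by rewrite -{1}[u]scale1r fl scale1r. Qed.

Lemma linear_Z c v : f (c *: v) = c *: f v.
Proof. by rewrite -[c *: v]addr0 fl linear_0 addr0. Qed.

Lemma linear_B u v : f (u - v) = f u - f v.
Proof. by rewrite linear_D -scaleN1r linear_Z scaleN1r. Qed.

Lemma linear_bigsum (I : Type) (s : seq I) (P : pred I) (F : I -> V) :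
  f (\sum_(i <- s | P i) F i) = \sum_(i <- s | P i) f (F i).
Proof. by apply: big_morph; [exact: linear_D|exact: linear_0]. Qed.

End LinearSums.

Section TensorProduct.
Variables (k : fieldType) (A B : comAlgType k).
Implicit Types (s t : seq (A * B)) (U : lmodType k).

(** A finite list of pairs stands for the sum of the corresponding pure tensors.
    Two lists are identified when no bilinear map into any vector space tells them
    apart, which makes the universal property of the tensor product immediate. *)
Definition tens_eval U (F : A -> B -> U) s := \sum_(p <- s) F p.1 p.2.
Definition tens_eq s t := forall U (F : A -> B -> U), bilinear_map F ->
  tens_eval F s = tens_eval F t.
Definition tens_opp s := [seq (- p.1, p.2) | p <- s].
Definition tens_mul s t := [seq (p.1 * q.1, p.2 * q.2) | p <- s, q <- t].
Definition tens_scale (c : k) s := [seq (c *: p.1, p.2) | p <- s].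

Lemma tens_eval_cat U (F : A -> B -> U) s t :
  tens_eval F (s ++ t) = tens_eval F s + tens_eval F t.
Proof. exact: big_cat. Qed.

Lemma tens_eval_opp U (F : A -> B -> U) s : bilinear_map F ->
  tens_eval F (tens_opp s) = - tens_eval F s.
Proof.
case=> Fl _; rewrite /tens_eval big_map -sumrN; apply: eq_bigr => p _ /=.
by rewrite -scaleN1r (linear_Z (Fl _)) scaleN1r.
Qed.

Lemma tens_eval_scale U (F : A -> B -> U) c s : bilinear_map F ->
  tens_eval F (tens_scale c s) = c *: tens_eval F s.
Proof.
case=> Fl _; rewrite /tens_eval big_map scaler_sumr; apply: eq_bigr => p _ /=.
by rewrite (linear_Z (Fl _)).
Qed.

Lemma tens_eval_mul U (F : A -> B -> U) s t :
  tens_eval F (tens_mul s t) =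
  tens_eval (fun a b => tens_eval (fun c d => F (a * c) (b * d)) t) s.
Proof. by rewrite /tens_eval big_allpairs_dep. Qed.

Lemma bilinear_mulr U (F : A -> B -> U) a b : bilinear_map F ->
  bilinear_map (fun c d => F (a * c) (b * d)).
Proof.
case=> Fl Fr; split=> w c u v; rewrite mulrDr -scalerAr.
  exact: Fl.
exact: Fr.
Qed.

Lemma bilinear_tens_eval U (F : A -> B -> U) t : bilinear_map F ->
  bilinear_map (fun a b => tens_eval (fun c d => F (a * c) (b * d)) t).
Proof.
case=> Fl Fr; split=> w c u v; rewrite /tens_eval scaler_sumr -big_split;
  apply: eq_bigr => p _ /=; rewrite mulrDl -scalerAl.
  exact: Fl.
exact: Fr.
Qed.

Lemma tens_mulC s t : tens_eq (tens_mul s t) (tens_mul t s).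
Proof.
move=> U F _; rewrite !tens_eval_mul /tens_eval exchange_big /=.
by apply: eq_bigr => p _; apply: eq_bigr => q _; rewrite !(mulrC p.1) !(mulrC p.2).
Qed.

Lemma tens_mulE s s' t t' : tens_eq s s' -> tens_eq t t' ->
  tens_eq (tens_mul s t) (tens_mul s' t').
Proof.
move=> hs ht U F Fb; rewrite !tens_eval_mul (hs _ _ (bilinear_tens_eval t Fb)).
by apply: eq_bigr => p _; apply/ht/bilinear_mulr.
Qed.

Lemma tens_mulA r s t :
  tens_eq (tens_mul r (tens_mul s t)) (tens_mul (tens_mul r s) t).
Proof.
move=> U F _; rewrite !tens_eval_mul; apply: eq_bigr => p _.
rewrite !tens_eval_mul; apply: eq_bigr => q _; apply: eq_bigr => q' _.
by rewrite !mulrA.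
Qed.

Lemma tens_mul1 s : tens_eq (tens_mul [:: (1, 1)] s) s.
Proof.
move=> U F _; rewrite !tens_eval_mul /tens_eval big_seq1 /=.
by apply: eq_bigr => p _; rewrite !mul1r.
Qed.

(** A linear functional f on A with f 1 = 1 gives the bilinear map
    a, b |-> f a b, which separates the unit from 0. *)
Lemma tens_unit_neq0 : ~ tens_eq [:: (1, 1)] [::].
Proof.
have [|||f [fl f1 _]] := @linear_functional k A [set 0] 1 => //.
- by move=> c w w' -> ->; rewrite scaler0 addr0.
- by move/eqP; rewrite oner_eq0.
have Fb : bilinear_map (fun a (b : B) => f a *: b).
  split=> [w c u v|v c u w]; last by rewrite scalerDr !scalerA mulrC.
  by rewrite fl scalerDl scalerA.
move=> /(_ B _ Fb); rewrite /tens_eval big_seq1 big_nil /= f1 scale1r.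
by move/eqP; rewrite oner_eq0.
Qed.

Definition tens_prealg : prealg k.
refine (@Prealg k (seq (A * B)) [::] [:: (1, 1)] cat tens_opp tens_mul tens_scale
  tens_eq _ _ _ _ _ tens_mulE _ _ _ _ _ tens_mulA tens_mulC tens_mul1 _
  tens_unit_neq0 _ _ _ _ _).
- by [].
- by move=> s t h U F Fb; rewrite h.
- by move=> r s t h h' U F Fb; rewrite h // h'.
- by move=> s s' t t' h h' U F Fb; rewrite !tens_eval_cat h // h'.
- by move=> s t h U F Fb; rewrite !tens_eval_opp // h.
- by move=> c s t h U F Fb; rewrite !tens_eval_scale // h.
- by move=> r s t U F Fb; rewrite catA.
- by move=> s t U F Fb; rewrite !tens_eval_cat addrC.
- by [].
- move=> s U F Fb; rewrite tens_eval_cat tens_eval_opp // addNr.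
  by rewrite /tens_eval big_nil.
- by move=> r s t U F Fb; rewrite !(tens_eval_mul, tens_eval_cat).
- by move=> c d s U F Fb; rewrite !tens_eval_scale // scalerA.
- by move=> s U F Fb; rewrite !tens_eval_scale // scale1r.
- by move=> c s t U F Fb; rewrite !(tens_eval_scale, tens_eval_cat) // scalerDr.
- by move=> c d s U F Fb; rewrite !(tens_eval_scale, tens_eval_cat) // scalerDl.
move=> c s t U F Fb; rewrite tens_eval_scale // !tens_eval_mul.
by rewrite tens_eval_scale //; apply: bilinear_tens_eval.
Defined.

Lemma tensor_product : exists (T : comAlgType k)
    (inl : {lrmorphism A -> T}) (inr : {lrmorphism B -> T}),
  (forall t : T, exists s : seq (A * B), t = \sum_(p <- s) inl p.1 * inr p.2) /\
  (forall U (F : A -> B -> U), bilinear_map F ->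
    exists phi : T -> U, linear phi /\ forall a b, phi (inl a * inr b) = F a b).
Proof.
have [T [pi [pisurj pieq pi1 pil piM]]] := prealg_quotient tens_prealg.
have piE s t : tens_eq s t -> pi s = pi t by move/pieq.
have pi0 : pi [::] = 0.
  by have := pil 1 [::] [::]; rewrite scale1r -[LHS]addr0 => /addrI <-.
have piD s t : pi (s ++ t) = pi s + pi t.
  rewrite -[X in _ = X + _]scale1r -pil; apply: piE => U F Fb.
  by rewrite !(tens_eval_cat, tens_eval_scale) // scale1r.
have [||| inl inlE] := @lrmorphism_intro k A T (fun a => pi [:: (a, 1)]) => //.
- move=> c a b; rewrite -pil; apply: piE => U F [Fl Fr].
  by rewrite /tens_eval /= !big_cons !big_nil /= Fl !addr0 (linear_Z (Fl _)).
- by move=> a b; rewrite -piM; apply: piE => U F _; rewrite /tens_eval !big_seq1 /= mulr1.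
have [||| inr inrE] := @lrmorphism_intro k B T (fun b => pi [:: (1, b)]) => //.
- move=> c a b; rewrite -pil; apply: piE => U F [Fl Fr].
  by rewrite /tens_eval /= !big_cons !big_nil /= Fr !addr0 (linear_Z (Fl _)).
- by move=> a b; rewrite -piM; apply: piE => U F _; rewrite /tens_eval !big_seq1 /= mulr1.
have inE a b : inl a * inr b = pi [:: (a, b)].
  rewrite inlE inrE -piM; apply: piE => U F _.
  by rewrite /tens_eval !big_seq1 /= mulr1 mul1r.
exists T, inl, inr; split=> [t|U F Fb].
  have [s ->] := pisurj t; exists s; elim: s => [|[a b] s IHs].
    by rewrite big_nil.
  by rewrite big_cons -IHs /= inE -piD.
pose rep (t : T) : seq (A * B) := projT1 (cid (pisurj t)).
have repP (t : T) : pi (rep t) = t by rewrite /rep; case: cid.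
exists (fun t : T => tens_eval F (rep t)); split=> [c t u|a b].
  rewrite -tens_eval_scale // -tens_eval_cat.
  suff E : tens_eq (rep (c *: t + u)) (tens_scale c (rep t) ++ rep u) by exact: E.
  by apply/pieq; rewrite repP pil !repP.
suff E : tens_eq (rep (inl a * inr b)) [:: (a, b)] by rewrite E // /tens_eval big_seq1.
by apply/pieq; rewrite repP inE.
Qed.

End TensorProduct.

(** The tensor product is the coproduct of commutative algebras, so a pair of
    points with values in R is a single point of it. *)
Lemma tensor_pairing (k : fieldType) (A B T : comAlgType k)
    (inl : {lrmorphism A -> T}) (inr : {lrmorphism B -> T}) :
  (forall t : T, exists s : seq (A * B), t = \sum_(p <- s) inl p.1 * inr p.2) ->
  (forall (U : lmodType k) (F : A -> B -> U), bilinear_map F ->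
    exists phi : T -> U, linear phi /\ forall a b, phi (inl a * inr b) = F a b) ->
  forall (R : comAlgType k) (x : {lrmorphism A -> R}) (y : {lrmorphism B -> R}),
  exists h : {lrmorphism T -> R}, (h \o inl =1 x) /\ (h \o inr =1 y).
Proof.
move=> gen univ R x y.
have [|phi [phil phiE]] := univ R (fun a b => x a * y b).
  split=> w c u v; first by rewrite linearP mulrDl scalerAl.
  by rewrite linearP mulrDr scalerAr.
have [|||h hE] := @lrmorphism_intro k T R phi => //.
- have -> : (1 : T) = inl 1 * inr 1 by rewrite !rmorph1 mulr1.
  by rewrite phiE !rmorph1 mulr1.
- move=> t u; have [s ->] := gen t; have [r ->] := gen u.
  rewrite !(linear_bigsum phil) big_distrlr (linear_bigsum phil) /= big_distrl /=.
  apply: eq_bigr => p _; rewrite big_distrr /= (linear_bigsum phil).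
  apply: eq_bigr => q _; rewrite mulrACA -!rmorphM !phiE !rmorphM.
  by rewrite mulrACA.
exists h; split=> a /=; rewrite hE.
  by rewrite -[inl a]mulr1 -(rmorph1 inr) phiE rmorph1 mulr1.
by rewrite -[inr a]mul1r -(rmorph1 inl) phiE rmorph1 mul1r.
Qed.

(** * Subalgebras, quotient algebras and reduced products *)

Section Subalgebra.
Variables (k : fieldType) (A : comAlgType k).

Lemma subalgebra_0 (B : set A) : subalgebra B -> B 0.
Proof. by case=> B1 Bl _; have := Bl (-1) _ _ B1 B1; rewrite scaleN1r addNr. Qed.

Lemma subalgebra_Z (B : set A) c a : subalgebra B -> B a -> B (c *: a).
Proof.
by move=> sB Ba; rewrite -[_ *: _]addr0; case: (sB) => _ Bl _; apply: Bl => //; apply: subalgebra_0.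
Qed.

Lemma subalgebra_D (B : set A) a b : subalgebra B -> B a -> B b -> B (a + b).
Proof. by case=> _ Bl _ Ba Bb; rewrite -[a]scale1r; apply: Bl. Qed.

Lemma subalgebra_N (B : set A) a : subalgebra B -> B a -> B (- a).
Proof. by move=> sB Ba; rewrite -scaleN1r; apply: subalgebra_Z. Qed.

Lemma subalgebra_carrier (B : set A) : subalgebra B ->
  exists (R : comAlgType k) (v : {lrmorphism R -> A}),
    injective v /\ forall a, B a <-> exists r, v r = a.
Proof.
move=> sB; have [B1 _ BM] := sB.
pose P : prealg k := ltac:(refine (@Prealg k {a | B a}
  (exist _ 0 (subalgebra_0 sB)) (exist _ 1 B1)
  (fun a b => exist _ _ (subalgebra_D sB (svalP a) (svalP b)))
  (fun a => exist _ _ (subalgebra_N sB (svalP a)))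
  (fun a b => exist _ _ (BM _ _ (svalP a) (svalP b)))
  (fun c a => exist _ _ (subalgebra_Z c sB (svalP a)))
  (fun a b => sval a = sval b) _ _ _ _ _ _ _ _ _ _ _ _ _ _ _ _ _ _ _ _ _);
  [by []|by []|by move=> a b c -> ->|by move=> a a' b b' /= -> ->
  |by move=> a a' /= ->|by move=> a a' b b' /= -> ->|by move=> c a a' /= ->
  |by move=> a b c /=; rewrite addrA|by move=> a b /=; rewrite addrC
  |by move=> a /=; rewrite add0r|by move=> a /=; rewrite addNr
  |by move=> a b c /=; rewrite mulrA|by move=> a b /=; rewrite mulrC
  |by move=> a /=; rewrite mul1r|by move=> a b c /=; rewrite mulrDl
  |by move=> /= /eqP; rewrite oner_eq0|by move=> c d a /=; rewrite scalerA
  |by move=> a /=; rewrite scale1r|by move=> c a b /=; rewrite scalerDr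
  |by move=> c d a /=; rewrite scalerDl|by move=> c a b /=; rewrite scalerAl]).
have [R [pi [pisurj pieq pi1 pil piM]]] := prealg_quotient P.
pose rep (t : R) : P := projT1 (cid (pisurj t)).
have repP (t : R) : pi (rep t) = t by rewrite /rep; case: cid.
have valE r : sval (rep (pi r)) = sval r by apply/(pieq (rep (pi r)) r); rewrite repP.
have [|||v vE] := @lrmorphism_intro k R A (fun r => sval (rep r)).
- by rewrite -pi1 valE.
- by move=> c a b; rewrite -{1}(repP a) -{1}(repP b) -pil valE.
- by move=> a b; rewrite -{1}(repP a) -{1}(repP b) -piM valE.
exists R, v; split=> [r s|a].
  by rewrite !vE -{2}(repP r) -{2}(repP s) => ?; apply/pieq.
split=> [Ba|[r <-]]; last by rewrite vE; apply: svalP.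
by exists (pi (exist _ a Ba)); rewrite vE valE.
Qed.

Definition alg_span (X : set A) : set A :=
  [set a | forall B, subalgebra B -> X `<=` B -> B a].

Lemma subalgebra_span X : subalgebra (alg_span X).
Proof.
split=> [B []//|c u v hu hv B sB XB|u v hu hv B sB XB].
  by case: (sB) => _ Bl _; apply: Bl; [apply: hu|apply: hv].
by case: (sB) => _ _ BM; apply: BM; [apply: hu|apply: hv].
Qed.

Lemma sub_alg_span X : X `<=` alg_span X.
Proof. by move=> a Xa B _; apply. Qed.

Lemma alg_span_min X B : subalgebra B -> X `<=` B -> alg_span X `<=` B.
Proof. by move=> sB XB a; apply. Qed.

Lemma alg_span_mono X Y : X `<=` Y -> alg_span X `<=` alg_span Y.
Proof.
move=> XY; apply: alg_span_min; first exact: subalgebra_span.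
by apply: (subset_trans XY); apply: sub_alg_span.
Qed.

Lemma quotient_algebra (D : set A) : ideal D -> ~ D 1 ->
  exists (R : comAlgType k) (pi : {lrmorphism A -> R}), forall a, pi a = 0 <-> D a.
Proof.
move=> [D0 DD DM] D1.
have DN a : D (- a) <-> D a.
  split; first by move=> ?; rewrite -[a]opprK -mulN1r; apply: DM.
  by move=> ?; rewrite -mulN1r; apply: DM.
have DZ c a : D a -> D (c *: a) by rewrite -[a in X in _ -> X]mul1r scalerAl => ?; apply: DM.
have zero a b : a = b -> D (a - b) by move=> ->; rewrite subrr.
have DE a a' b b' : D (a - a') -> D (b - b') -> D (a * b - a' * b').
  move=> h h'.
  have -> : a * b - a' * b' = b * (a - a') + a' * (b - b').
    by rewrite !mulrBr !(mulrC b) subrKA.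
  by apply: DD; apply: DM.
pose P : prealg k := ltac:(refine (@Prealg k A 0 1 +%R -%R *%R *:%R
  (fun a b => D (a - b)) _ _ _ _ _ _ _ _ _ _ _ _ _ _ _ _ _ _ _ _ _);
  [by move=> a; apply: zero|by move=> a b; rewrite -DN opprB
  |by move=> a b c h h'; rewrite -(subrKA b); apply: DD
  |by move=> a a' b b' h h'; rewrite opprD addrACA; apply: DD
  |by move=> a a' h; rewrite -opprD DN
  |exact: DE|by move=> c a a' h; rewrite -scalerBr; apply: DZ
  |by move=> a b c; apply/zero; rewrite addrA|by move=> a b; apply/zero; rewrite addrC
  |by move=> a; apply/zero; rewrite add0r|by move=> a; apply/zero; rewrite addNr
  |by move=> a b c; apply/zero; rewrite mulrA|by move=> a b; apply/zero; rewrite mulrC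
  |by move=> a; apply/zero; rewrite mul1r|by move=> a b c; apply/zero; rewrite mulrDl
  |by rewrite subr0|by move=> c d a; apply/zero; rewrite scalerA
  |by move=> a; apply/zero; rewrite scale1r|by move=> c a b; apply/zero; rewrite scalerDr
  |by move=> c d a; apply/zero; rewrite scalerDl
  |by move=> c a b; apply/zero; rewrite scalerAl]).
have [R [pi [pisurj pieq pi1 pil piM]]] := prealg_quotient P.
have [|||v vE] := @lrmorphism_intro k A R pi => //.
exists R, v => a.
have -> : (0 : R) = pi 0 by rewrite -vE linear0.
by rewrite vE pieq /= subr0.
Qed.

End Subalgebra.

(** The product of the algebras A_i, modulo equality for all large indices, receives
    them compatibly.  An element of A_i goes to the family of its images in the
    A_j with i <= j, filled up by 0; since the transition maps are injective, no
    nonzero element is lost.  This gives an ambient algebra without a construction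
    of the direct limit. *)
Lemma reduced_product (k : fieldType) (I : Type) (le : I -> I -> Prop)
    (A : I -> comAlgType k) (t : forall i j, le i j -> {lrmorphism A i -> A j}) :
  directed le ->
  (forall i (h : le i i), t i i h =1 id) ->
  (forall i j l (hij : le i j) (hjl : le j l) (hil : le i l),
     t i l hil =1 t j l hjl \o t i j hij) ->
  (forall i j (h : le i j), injective (t i j h)) ->
  exists (M : comAlgType k) (x : forall i, {lrmorphism A i -> M}),
    (forall i, injective (x i)) /\ forall i j (h : le i j), x j \o t i j h =1 x i.
Proof.
move=> [[i0] lexx letr ledir] t1 tc tinj.
pose ev (a b : forall i, A i) := exists i, forall j, le i j -> a j = b j.
have all_ev (a b : forall i, A i) : (forall i, a i = b i) -> ev a b by exists i0.
have evT (a a' b b' c c' : forall i, A i) : (forall i, a i = a' i -> b i = b' i -> c i = c' i) ->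
    ev a a' -> ev b b' -> ev c c'.
  move=> h [i hi] [j hj]; have [l il jl] := ledir i j; exists l => m lm.
  by apply: h; [apply: hi|apply: hj]; apply: letr lm.
have evU (a a' c c' : forall i, A i) : (forall i, a i = a' i -> c i = c' i) ->
    ev a a' -> ev c c'.
  by move=> h e; apply: (evT a a' a a') => // i e1 _; apply: h.
pose P : prealg k := ltac:(refine (@Prealg k (forall i, A i) (fun=> 0) (fun=> 1)
  (fun a b i => a i + b i) (fun a i => - a i) (fun a b i => a i * b i)
  (fun c a i => c *: a i) ev _ _ _ _ _ _ _ _ _ _ _ _ _ _ _ _ _ _ _ _ _);
  [by move=> a; apply: all_ev|by move=> a b; apply: evU
  |by move=> a b c; apply: evT => i -> ->
  |by move=> a a' b b'; apply: evT => i -> ->|by move=> a a'; apply: evU => i ->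
  |by move=> a a' b b'; apply: evT => i -> ->|by move=> c a a'; apply: evU => i ->
  |by move=> a b c; apply: all_ev => i; rewrite addrA
  |by move=> a b; apply: all_ev => i; rewrite addrC
  |by move=> a; apply: all_ev => i; rewrite add0r
  |by move=> a; apply: all_ev => i; rewrite addNr
  |by move=> a b c; apply: all_ev => i; rewrite mulrA
  |by move=> a b; apply: all_ev => i; rewrite mulrC
  |by move=> a; apply: all_ev => i; rewrite mul1r
  |by move=> a b c; apply: all_ev => i; rewrite mulrDl
  |by case=> i /(_ i (lexx i)) /eqP; rewrite oner_eq0
  |by move=> c d a; apply: all_ev => i; rewrite scalerA
  |by move=> a; apply: all_ev => i; rewrite scale1r
  |by move=> c a b; apply: all_ev => i; rewrite scalerDr
  |by move=> c d a; apply: all_ev => i; rewrite scalerDl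
  |by move=> c a b; apply: all_ev => i; rewrite scalerAl]).
have [M [pi [_ pieq pi1 pil piM]]] := prealg_quotient P.
have piE (a b : forall i, A i) : ev a b -> pi a = pi b by move=> e; apply/pieq.
pose f i (a : A i) : forall j, A j :=
  fun j => if pselect (le i j) is left h then t i j h a else 0.
have fE i (a : A i) j (h : le i j) : f i a j = t i j h a.
  by rewrite /f; case: pselect => // h'; rewrite (Prop_irrelevance h h').
have Hx i : exists x : {lrmorphism A i -> M}, x =1 (fun a => pi (f i a)).
  apply: lrmorphism_intro.
  - by rewrite -pi1; apply: piE; exists i => j h; rewrite fE rmorph1.
  - by move=> c a b; rewrite -pil; apply: piE; exists i => j h; rewrite /= !fE linearP.
  - by move=> a b; rewrite -piM; apply: piE; exists i => j h; rewrite /= !fE rmorphM.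
exists M, (fun i => projT1 (cid (Hx i))); split=> [i a b|i j h a /=].
  case: cid => x xE /=; rewrite !xE => /pieq[j hj].
  have [l il jl] := ledir i j; have := hj _ jl; rewrite !fE.
  exact: tinj.
case: cid => x xE; case: cid => y yE /=; rewrite xE yE; apply: piE.
exists j => l jl; rewrite fE (fE _ _ _ (letr _ _ _ h jl)).
by rewrite (tc _ _ _ h jl).
Qed.

(** * Points, coproducts and homomorphisms *)

Section Points.
Variables (k : fieldType) (G : progroup k).
Implicit Types R S : comAlgType k.

Lemma pmulgV R (x : pt G R) : pmul x (pinv x) = pone G R.
Proof.
rewrite -[LHS]pmul1g -{1}(pmulVg (pinv x)) -!pmulA (pmulA (pinv x)) pmulVg pmul1g.
exact: pmulVg.
Qed.

Lemma pmulg1 R (x : pt G R) : pmul x (pone G R) = x.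
Proof. by rewrite -(pmulVg x) pmulA pmulgV pmul1g. Qed.

Lemma pmul_idem R (x : pt G R) : pmul x x = x -> x = pone G R.
Proof. by move=> xx; rewrite -(pmulVg x) -{3}xx pmulA pmulVg pmul1g. Qed.

Lemma pmul_eq1 R (x y : pt G R) : pmul x y = pone G R -> x = pinv y.
Proof. by move=> xy; rewrite -[x]pmulg1 -(pmulgV y) pmulA xy pmul1g. Qed.

Lemma pone_nat R S (f : {lrmorphism R -> S}) :
  (f \o pone G R : pt G S) = pone G S.
Proof. by apply: pmul_idem; rewrite -pmul_nat pmul1g. Qed.

Lemma pinv_nat R S (f : {lrmorphism R -> S}) (x : pt G R) :
  (f \o pinv x : pt G S) = pinv (f \o x : pt G S).
Proof. by apply: pmul_eq1; rewrite -pmul_nat pmulVg pone_nat. Qed.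

Definition antipode : pt G (coordring G) := pinv (idfun : pt G (coordring G)).
(** The regular algebra k^o is k itself, viewed as an algebra over k. *)
Definition counit : pt G k^o := pone G k^o.

Lemma pinvE R (x : pt G R) a : pinv x a = x (antipode a).
Proof.
have -> : x = (x \o (idfun : pt G (coordring G)) : pt G R) by apply: lrmorph_ext.
by rewrite -pinv_nat.
Qed.

Lemma poneE R a : pone G R a = (counit a)%:A.
Proof.
have [|||f fE] := @lrmorphism_intro k k^o R (fun c => c%:A).
- by rewrite scale1r.
- by move=> c u v; rewrite scalerDl scalerA.
- by move=> u v; rewrite -scalerAl mul1r scalerA.
by rewrite -(pone_nat f) -fE.
Qed.

End Points.

Section HomPoints.
Variables (k : fieldType) (G H : progroup k) (f : pghom G H).
Implicit Types R : comAlgType k.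

Lemma map_pt1 R : map_pt f (pone G R) = pone H R.
Proof. by apply: pmul_idem; rewrite /map_pt -comapM pmul1g. Qed.

Lemma map_ptV R (x : pt G R) : map_pt f (pinv x) = pinv (map_pt f x).
Proof. by apply: pmul_eq1; rewrite /map_pt -comapM pmulVg; apply: map_pt1. Qed.

Lemma map_ptM R (x y : pt G R) : map_pt f (pmul x y) = pmul (map_pt f x) (map_pt f y).
Proof. exact: comapM. Qed.

Lemma comap_antipode h : antipode G (comap f h) = comap f (antipode H h).
Proof.
have /(congr1 (fun x : pt H _ => x h)) /= := map_ptV (idfun : pt G (coordring G)).
by rewrite [RHS]pinvE.
Qed.

End HomPoints.

Section Detection.
Variable k : fieldType.
Implicit Types R S : comAlgType k.

(** The inclusions of A and B into their tensor product are universal points, so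
    an identity that holds at all points holds for all bilinear maps. *)
Lemma bilinear_detection (A B : comAlgType k) (s t : seq (A * B)) :
  (forall R (x : {lrmorphism A -> R}) (y : {lrmorphism B -> R}),
     \sum_(p <- s) x p.1 * y p.2 = \sum_(p <- t) x p.1 * y p.2) ->
  forall (U : lmodType k) (F : A -> B -> U), bilinear_map F ->
    \sum_(p <- s) F p.1 p.2 = \sum_(p <- t) F p.1 p.2.
Proof.
move=> E U F Fb; have [T [inl [inr [_ univ]]]] := tensor_product A B.
have [phi [phil phiE]] := univ U F Fb.
suff evE r : \sum_(p <- r) F p.1 p.2 = phi (\sum_(p <- r) inl p.1 * inr p.2).
  by rewrite !evE E.
by rewrite (linear_bigsum phil); apply: eq_bigr => p _; rewrite phiE.
Qed.

Lemma linear_mul2 (A B R : comAlgType k) (f : A -> R) (g : B -> R) :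
  linear f -> linear g -> bilinear_map (fun a b => f a * g b).
Proof.
move=> fl gl; split=> w c u v; first by rewrite fl mulrDl scalerAl.
by rewrite gl mulrDr scalerAr.
Qed.

(** The three-fold analogue, which associativity needs; products of three linear
    maps are the only trilinear maps that occur. *)
Lemma trilinear_detection (A : comAlgType k) (s t : seq (A * (A * A))) :
  (forall R (x y z : {lrmorphism A -> R}),
     \sum_(p <- s) x p.1 * (y p.2.1 * z p.2.2) =
     \sum_(p <- t) x p.1 * (y p.2.1 * z p.2.2)) ->
  forall (R : comAlgType k) (f g h : A -> R), linear f -> linear g -> linear h ->
    \sum_(p <- s) f p.1 * (g p.2.1 * h p.2.2) =
    \sum_(p <- t) f p.1 * (g p.2.1 * h p.2.2).
Proof.
move=> E R f g h fl gl hl; have [T [inl [inr [_ univ]]]] := tensor_product A A.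
have [phi [phil phiE]] := univ R _ (linear_mul2 gl hl).
pose in2 (p : A * (A * A)) := (p.1, inl p.2.1 * inr p.2.2).
suff evE r : \sum_(p <- r) f p.1 * (g p.2.1 * h p.2.2) =
    \sum_(p <- map in2 r) f p.1 * phi p.2.
  rewrite !evE; apply: bilinear_detection (linear_mul2 fl phil) => S x y.
  rewrite !big_map /=; under eq_bigr do rewrite rmorphM.
  by under [RHS]eq_bigr do rewrite rmorphM; apply: (E S x (y \o inl) (y \o inr)).
by rewrite big_map; apply: eq_bigr => p _; rewrite phiE.
Qed.

End Detection.

Section Coproduct.
Variables (k : fieldType) (G : progroup k).
Local Notation A := (coordring G).
Implicit Types R : comAlgType k.

Definition coproduct (a : A) (s : seq (A * A)) : Prop :=
  forall R (x y : pt G R), pmul x y a = \sum_(p <- s) x p.1 * y p.2.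

(** Multiply the two universal points of G in the tensor square of its ring and
    expand the result; naturality carries the expansion to all other points. *)
Lemma coproduct_exists a : exists s, coproduct a s.
Proof.
have [T [inl [inr [gen univ]]]] := tensor_product A A.
have [s sE] := gen (pmul (inl : pt G T) (inr : pt G T) a); exists s => R x y.
have [h [hl hr]] := tensor_pairing gen univ x y.
have -> : x = (h \o inl : pt G R) by apply: lrmorph_ext => b; rewrite -hl.
have -> : y = (h \o inr : pt G R) by apply: lrmorph_ext => b; rewrite -hr.
rewrite -pmul_nat /= sE rmorph_sum /=; apply: eq_bigr => p _.
exact: rmorphM.
Qed.

(** A dual family certifies that the v_i are linearly independent, in the form in
    which independence is used: l_i extracts the coefficient of v_i. *)
Definition dual_family n (v : 'I_n -> A) (l : 'I_n -> A -> k) : Prop :=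
  (forall i, linear (l i : A -> k^o)) /\ forall i j, l i (v j) = (i == j)%:R.

(** If some v_j is a combination of the others, it can be eliminated and the sum
    becomes shorter.  Otherwise each v_j lies outside the span of the others, and
    functionals that vanish on these spans are dual to the family. *)
Lemma reduced_tensor n (u v : 'I_n -> A) :
  exists m (u' v' : 'I_m -> A) (l : 'I_m -> A -> k), dual_family v' l /\
  forall R (x y : pt G R), \sum_i x (u i) * y (v i) = \sum_i x (u' i) * y (v' i).
Proof.
elim: n => [|n IHn] in u v *.
  by exists 0%N, u, v, (fun i _ => 0); split=> //; split=> -[].
pose W j := [set w | exists d : 'I_n.+1 -> k, d j = 0 /\ w = \sum_i d i *: v i].
have [[j [d [dj vj]]]|free] := pselect (exists j, W j (v j)).
  have [m [u' [v' [l [dual E]]]]] :=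
    IHn (fun i => u (lift j i) + d (lift j i) *: u j) (fun i => v (lift j i)).
  exists m, u', v', l; split=> // R x y; rewrite -E (bigD1_ord j) //=.
  rewrite {1}vj (bigD1_ord j) //= dj scale0r add0r linear_sum mulr_sumr -big_split /=.
  apply: eq_bigr => i _; rewrite linearD !linearZ /= mulrDl -scalerAl -scalerAr.
  by rewrite addrC.
have /choice[l lP] : forall j, exists f : A -> k,
    [/\ linear (f : A -> k^o), f (v j) = 1 & forall w, W j w -> f w = 0].
  move=> j; apply: linear_functional => [|c w w' [d [dj ->]] [e [ej ->]]|h].
  - exists (fun=> 0); split=> //; rewrite big1 // => i _.
    exact: scale0r.
  - exists (fun i => c * d i + e i); rewrite dj ej mulr0 addr0; split=> //.
    rewrite scaler_sumr -big_split; apply: eq_bigr => i _ /=.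
    by rewrite scalerDl scalerA.
  - by apply: free; exists j.
exists n.+1, u, v, l; split=> //; split=> [i|i j]; first by have [] := lP i.
have [<-|ij] := eqVneq; first by have [] := lP i.
have [_ _ ->] := lP i => //.
exists (fun j' => (j' == j)%:R); split; first by rewrite (negbTE ij).
rewrite (bigD1 j) //= eqxx scale1r big1 ?addr0 // => j' /negbTE ->.
exact: scale0r.
Qed.

Lemma reduced_coproduct a : exists n (u v : 'I_n -> A) (l : 'I_n -> A -> k),
  dual_family v l /\ forall R (x y : pt G R), pmul x y a = \sum_i x (u i) * y (v i).
Proof.
have [s sE] := coproduct_exists a.
have [m [u' [v' [l [dual E]]]]] :=
  reduced_tensor (fun i : 'I_(size s) => (nth 0 s i).1) (fun i => (nth 0 s i).2).
by exists m, u', v', l; split=> // R x y; rewrite sE (big_nth 0) big_mkord E.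
Qed.

End Coproduct.

(** An inclusion of Hopf subalgebras of k[G] is automatically compatible with their
    coproducts: both coproducts are restrictions of that of k[G], and the tensor
    square of the larger subalgebra embeds into that of k[G], because the subalgebra
    has a linear retraction. *)
Lemma hom_factor (k : fieldType) (G H1 H2 : progroup k) (f1 : pghom G H1)
    (f2 : pghom G H2) : epi f2 ->
  (forall a, exists b, comap f2 b = comap f1 a) ->
  exists g : pghom H2 H1, hom_eq (comp_hom g f2) f1.
Proof.
move=> e2 sub; have /choice[c cE] := sub.
have [|||c' c'E] := @lrmorphism_intro k _ _ c.
- by apply: e2; rewrite cE !rmorph1.
- by move=> d a b; apply: e2; rewrite cE !linearP /= !cE.
- by move=> a b; apply: e2; rewrite cE !rmorphM /= !cE.
suff cM (R : comAlgType k) (x y : pt H2 R) :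
    comap_pt c' (pmul x y) = pmul (comap_pt c' x) (comap_pt c' y).
  by exists (Hom cM) => a /=; rewrite c'E cE.
apply: lrmorph_ext => a /=; have [s1 E1] := coproduct_exists a.
have [s2 E2] := coproduct_exists (c a); rewrite c'E E1 E2.
have [r [rl rK]] := linear_left_inverse (linearP (comap f2)) e2.
pose m2 p : coordring G * coordring G := (comap f2 p.1, comap f2 p.2).
pose m1 p : coordring G * coordring G := (comap f1 p.1, comap f1 p.2).
have xr (z : pt H2 R) : linear (fun a => z (r a)) by move=> d u v; rewrite rl linearP.
have -> : \sum_(p <- s2) x p.1 * y p.2 = \sum_(p <- map m2 s2) x (r p.1) * y (r p.2).
  by rewrite big_map; apply: eq_bigr => p _; rewrite !rK.
have -> : \sum_(p <- s1) comap_pt c' x p.1 * comap_pt c' y p.2 =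
          \sum_(p <- map m1 s1) x (r p.1) * y (r p.2).
  by rewrite big_map; apply: eq_bigr => p _; rewrite /= -!cE !rK !c'E.
apply: bilinear_detection (linear_mul2 (xr x) (xr y)) => S x' y'.
rewrite !big_map /=.
have /= <- := E2 S (map_pt f2 x') (map_pt f2 y').
have /= <- := E1 S (map_pt f1 x') (map_pt f1 y').
by rewrite /map_pt -!comapM /= cE.
Qed.

(** * A functional on a finitely generated module *)

Lemma det_repeated_column (B : comNzRingType) s n (M : 'M[B]_(s, n)) (g : 'I_s -> 'I_n) :
  \det (\matrix_(i, j) M i (g j)) != 0 -> injective g.
Proof.
move=> /eqP d0 i j gij; apply: contrapT => /eqP ij; apply: d0.
rewrite -det_tr; apply: (determinant_alternate ij) => l.
by rewrite !mxE gij.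
Qed.

(** Let v_0 = 1, v_1, ..., v_n generate a B-submodule of A.  The w_i are the values
    at the v_i of a B-linear functional into B with nonzero value at 1.  Take a
    nonvanishing minor, of maximal size s, of a matrix of relations between the
    v_i, with columns avoiding the index 0.  For r in B^(n+1), consider the
    determinant of size s+1 obtained by adding the row r and the column 0: it is
    linear in r, and it is the minor at r = (1, 0, ..., 0), which represents 1.  Let r
    be a relation, and let rho_a be the determinant with column a in place of column
    0.  Expanding along that column shows that rho is a combination of relations,
    hence a relation; but rho_a = 0 for a <> 0 by maximality, so rho_0 v_0 = 0, and
    rho_0 = 0 as B embeds into A. *)
Lemma nonvanishing_functional (B A : comNzRingType) (c : {rmorphism B -> A}) n
    (v : 'I_n.+1 -> A) : injective c -> v ord0 = 1 ->
  exists w : 'I_n.+1 -> B, w ord0 != 0 /\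
    forall r : 'I_n.+1 -> B, \sum_i c (r i) * v i = 0 -> \sum_i r i * w i = 0.
Proof.
move=> ci v0; pose rel (r : 'I_n.+1 -> B) := \sum_i c (r i) * v i = 0.
(* the columns of the minor are the indices lift ord0 (g j), all nonzero *)
pose minor s := exists (M : 'M[B]_(s, n.+1)) (g : 'I_s -> 'I_n),
  (forall i, rel (M i)) /\ \det (\matrix_(i, j) M i (lift ord0 (g j))) != 0.
have ex0 : exists s, `[< minor s >].
  exists 0%N; apply/asboolP.
  have e T (i : 'I_0) : T by case: i.
  exists 0, (e _); split=> [i|]; first exact: e.
  by rewrite det_mx00 oner_eq0.
have bound s : `[< minor s >] -> (s <= n)%N.
  move=> /asboolP[M [g [_]]] /det_repeated_column h.
  have /leq_card : injective g by move=> i j gij; apply: h; rewrite gij.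
  by rewrite !card_ord.
have [s /asboolP[M [g [Mrel Mdet]]] smax] := ex_maxnP ex0 bound.
(* row 0 is r, the other rows are those of M; column 0 of X r a is the column a *)
pose N (r : 'I_n.+1 -> B) : 'M[B]_(s.+1, n.+1) :=
  \matrix_(i, a) if unlift ord0 i is Some i' then M i' a else r a.
pose h (a : 'I_n.+1) (j : 'I_s.+1) :=
  if unlift ord0 j is Some j' then lift ord0 (g j') else a.
pose X r a := \matrix_(i, j) N r i (h a j).
have X_col r a : \det (X r a) = \sum_i N r i a * cofactor (X r ord0) i ord0.
  rewrite (expand_det_col _ ord0); apply: eq_bigr => i _; rewrite mxE /h unlift_none.
  congr (_ * (_ * \det _)); apply/matrixP => l m.
  by rewrite !mxE /h liftK.
have X_row r : \det (X r ord0) = \sum_j r (h ord0 j) * cofactor (X (fun=> 0) ord0) ord0 j.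
  rewrite (expand_det_row _ ord0); apply: eq_bigr => j _; rewrite !mxE unlift_none.
  congr (_ * (_ * \det _)); apply/matrixP => l m.
  by rewrite !mxE liftK.
have X0 r : rel r -> \det (X r ord0) = 0.
  move=> rr; have Nrel i : rel (N r i).
    rewrite /rel; under eq_bigr do rewrite mxE.
    by case: unliftP => [i' _|_]; [exact: (Mrel i')|exact: rr].
  have Xl a : \det (X r (lift ord0 a)) = 0.
    apply: contrapT => /eqP d; have := smax s.+1; rewrite ltnn => H.
    suff: false by []; apply: H; apply/asboolP.
    exists (N r), (fun j => if unlift ord0 j is Some j' then g j' else a); split=> //.
    suff -> : (\matrix_(i, j) N r i (lift ord0
       (if unlift ord0 j is Some j' then g j' else a))) = X r (lift ord0 a) by [].
    by apply/matrixP => i j; rewrite !mxE /h; case: (unlift ord0 j).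
  apply: ci; rewrite rmorph0.
  suff : \sum_a c (\det (X r a)) * v a = 0.
    rewrite (bigD1_ord ord0) //= big1 => [|a _]; last by rewrite Xl rmorph0 mul0r.
    by rewrite addr0 v0 mulr1.
  under eq_bigr do rewrite X_col rmorph_sum mulr_suml.
  rewrite exchange_big big1 //= => i _.
  under eq_bigr do rewrite rmorphM mulrAC.
  by rewrite -mulr_suml Nrel mul0r.
exists (fun a => \sum_(j | h ord0 j == a) cofactor (X (fun=> 0) ord0) ord0 j).
split=> [|r /X0 E].
  rewrite (big_pred1 ord0) => [|j]; last first.
    rewrite /h /=; case: unliftP => [j' ->|->]; last by rewrite !eqxx.
    by rewrite !(eq_sym _ ord0) !(negbTE (neq_lift _ _)).
  rewrite /cofactor expr0 mul1r.
  suff -> : row' ord0 (col' ord0 (X (fun=> 0) ord0)) =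
    \matrix_(i, j) M i (lift ord0 (g j)) by [].
  by apply/matrixP => i j; rewrite !mxE /h !liftK.
rewrite -[RHS]E X_row (partition_big (h ord0) predT) //=; apply: eq_bigr => a _.
by rewrite mulr_sumr; apply: eq_bigr => j /eqP ->.
Qed.

(** * Epimorphisms with trivial kernel are isomorphisms *)

Section TrivialKernel.
Variables (k : fieldType) (G H : progroup k) (f : pghom G H).
Hypothesis f_epi : epi f.
Hypothesis f_ker : forall (R : comAlgType k) (x : pt G R), map_pt f x = pone H R -> x = pone G R.
Local Notation A := (coordring G).
Local Notation B := (coordring H).
Local Notation c := (comap f).

(** The quotient of two points with the same image lies in the kernel. *)
Lemma map_pt_inj (R : comAlgType k) (x y : pt G R) : map_pt f x = map_pt f y -> x = y.
Proof.
move=> E; have /pmul_eq1 -> : pmul x (pinv y) = pone G R.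
  by apply: f_ker; rewrite map_ptM E -map_ptM pmulgV map_pt1.
by apply/esym/pmul_eq1/pmulgV.
Qed.

(** The universal pair of points that agree on B takes its values in the quotient of
    A (x) A by the ideal D generated by the differences of the two images of B.
    These points are equal, so the difference of the two images of a_i lies in D:
    it is a finite sum of terms (b (x) 1 - 1 (x) b)(x (x) y).  On the B-submodule
    generated by 1, the a_i and all the y there is a B-linear functional into B with
    nonzero value at 1; let pi' extend it linearly to A.  The map x (x) y |-> x pi' y
    kills these terms, and so it gives a_i pi' 1 = pi' a_i, which is in B. *)
Lemma common_denominator n (a : 'I_n -> A) :
  exists b : B, b != 0 /\ forall i, exists b', c b' = c b * a i.
Proof.
have [T [inl [inr [gen univ]]]] := tensor_product A A.
pose term (p : B * (A * A)) := (inl (c p.1) - inr (c p.1)) * (inl p.2.1 * inr p.2.2).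
pose D := [set t | exists s : seq (B * (A * A)), t = \sum_(p <- s) term p].
have Did : ideal D.
  split=> [|_ _ [s ->] [t ->]|t _ [s ->]]; first by exists [::]; rewrite big_nil.
    by exists (s ++ t); rewrite big_cat.
  have [r ->] := gen t.
  exists [seq (p.1, (q.1 * p.2.1, q.2 * p.2.2)) | q <- r, p <- s].
  rewrite big_allpairs_dep big_distrl; apply: eq_bigr => q _ /=.
  rewrite big_distrr; apply: eq_bigr => p _ /=.
  by rewrite /term /= mulrCA !rmorphM (mulrACA (inl q.1)).
have D1 : ~ D 1.
  move=> [s E]; have [h [hl hr]] := tensor_pairing gen univ idfun idfun.
  have := rmorph1 h; rewrite E rmorph_sum big1 => [/eqP|p _].
    by rewrite eq_sym oner_eq0.
  rewrite rmorphM rmorphB; have /= -> := hl (c p.1); have /= -> := hr (c p.1).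
  by rewrite subrr mul0r.
have [R [pi piD]] := quotient_algebra Did D1.
have /choice[s sE] : forall i, D (inl (a i) - inr (a i)).
  move=> i; apply/piD; rewrite rmorphB; apply/eqP; rewrite subr_eq0; apply/eqP.
  have E : (pi \o inl : pt G R) = (pi \o inr : pt G R).
    apply: map_pt_inj; apply: lrmorph_ext => b /=.
    apply/eqP; rewrite -subr_eq0 -rmorphB; apply/eqP/piD.
    by exists [:: (b, (1, 1))]; rewrite big_seq1 /term /= !rmorph1 !mulr1.
  exact: (congr1 (fun x : pt G R => x (a i)) E).
pose Y := codom a ++ flatten [seq [seq p.2.2 | p <- s i] | i : 'I_n].
pose v (i : 'I_(size Y).+1) := nth 0 (1 :: Y) i.
have vP y : y \in Y -> exists i, v i = y.
  move=> Yy; have lt : ((index y Y).+1 < (size Y).+1)%N by rewrite ltnS index_mem.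
  by exists (Ordinal lt); rewrite /v /= nth_index.
have [w [w0 wrel]] := nonvanishing_functional (f_epi : injective c) (erefl : v ord0 = 1).
have [||pi' [pil piE]] := @linear_extension k A A
    [set z | exists r : 'I_(size Y).+1 -> B,
       z.1 = \sum_i c (r i) * v i /\ z.2 = \sum_i c (r i * w i)].
- by exists (fun=> 0); split; rewrite big1 // => i _; rewrite ?mul0r rmorph0 ?mul0r.
- split=> [d z z' [r [Ez1 Ez2]] [r' [Ez1' Ez2']]|u [r /= [/esym/wrel E ->]]]; last first.
    by rewrite -rmorph_sum E rmorph0.
  exists (fun i => d *: r i + r' i); rewrite /= Ez1 Ez2 Ez1' Ez2' !scaler_sumr -!big_split.
  split; apply: eq_bigr => i _ /=; first by rewrite linearP mulrDl scalerAl.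
  by rewrite mulrDl linearD -scalerAl linearZ.
have pi'v b i : pi' (c b * v i) = c (b * w i).
  rewrite (piE (c b * v i, c (b * w i))) //=.
  exists (fun j => if j == i then b else 0); rewrite (bigD1 i) //= eqxx big1 ?addr0; last first.
    by move=> j /negbTE ->; rewrite rmorph0 mul0r.
  split=> //; rewrite (bigD1 i) //= eqxx big1 ?addr0 // => j /negbTE ->.
  by rewrite mul0r rmorph0.
have pi'v1 i : pi' (v i) = c (w i) by rewrite -[v i]mul1r -(rmorph1 c) pi'v mul1r.
exists (w ord0); split=> // i.
have [j vj] : exists j, v j = a i.
  by apply: vP; rewrite mem_cat codom_f.
exists (w j); rewrite -pi'v1 vj.
have [phi [phil phiE]] := univ A _ (linear_mul2 (fun d u v => erefl : id (d *: u + v) = _) pil).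
suff : phi (inl (a i) - inr (a i)) = 0.
  rewrite -[inl _]mulr1 -(rmorph1 inr) -[X in _ - X]mul1r -(rmorph1 inl).
  rewrite linear_B // !phiE mul1r => /eqP; rewrite subr_eq0 => /eqP <-.
  by rewrite -(pi'v1 ord0) mulrC.
rewrite sE linear_bigsum // big1_seq // => p /andP[_ ps].
have [l vl] : exists l, v l = p.2.2.
  apply: vP; rewrite mem_cat; apply/orP; right; apply/flattenP.
  by exists [seq p.2.2 | p <- s i]; [apply/mapP; exists i; rewrite ?mem_enum|apply: map_f].
rewrite /term mulrBl mulrA -rmorphM (mulrCA (inr _)) -rmorphM linear_B // !phiE.
by rewrite -vl pi'v pi'v1 rmorphM (mulrCA p.2.1) mulrA subrr.
Qed.

Section Conductor.
Variables (a : A) (n : nat) (u v : 'I_n -> A) (l : 'I_n -> A -> k).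
Hypothesis dual : dual_family v l.
Hypothesis aE : forall (R : comAlgType k) (x y : pt G R), pmul x y a = \sum_i x (u i) * y (v i).

(** The coproduct of a is the sum of the u_i (x) v_i with v_i independent, so the
    u_i span the translates of a.  Treating all of them at once is what makes the
    conductor stable under translation. *)
Definition conductor (b : B) := forall i, exists b', c b' = c b * u i.

(** For generic points x, y, z write
      b(xy) a(xz) = sum_i (b u_i)(xy) v_i(y^-1 z),
    which holds since xz = (xy)(y^-1 z).  If b is in the conductor, the right-hand
    side depends on x only through functions in B.  Expanding the left-hand side
    and extracting the coefficients of q_j(y) and v_i(z) gives p_j u_i, so this
    is in B. *)
Lemma conductor_translate b m (p q : 'I_m -> B) (mu : 'I_m -> B -> k) :
  dual_family q mu ->
  (forall (R : comAlgType k) (x y : pt H R), pmul x y b = \sum_j x (p j) * y (q j)) ->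
  conductor b -> forall j, conductor (p j).
Proof.
move=> [mul muq] bE /choice[b' b'E] j i; have [ll lv] := dual.
have [rho [rhol rhoK]] := linear_left_inverse (linearP c) f_epi.
have [T [y0 [z0 [_ univT]]]] := tensor_product A A.
have [R [x [inr [_ univR]]]] := tensor_product A T.
have ml : linear (fun a => mu j (rho a) : k^o) by move=> d s t; rewrite rhol mul.
(* nu extracts the coefficient of q_j (x) v_i *)
have [nu [nul nuE]] := univT k^o _ (linear_mul2 (ml : linear (_ : A -> k^o)) (ll i)).
have Fb : bilinear_map (fun (s : A) (t : T) => (nu t : k) *: s).
  split=> [t d s s'|s d t t']; first by rewrite scalerDr !scalerA mulrC.
  by rewrite nul scalerDl scalerA.
have [Phi [Phil PhiE]] := univR A _ Fb.
pose y : pt G R := inr \o y0; pose z : pt G R := inr \o z0.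
pose g : pt G T := pmul (pinv (y0 : pt G T)) (z0 : pt G T).
have E : pmul (x : pt G R) y (c b) * pmul (x : pt G R) z a =
    \sum_i' pmul (x : pt G R) y (c (b' i')) * inr (g (v i')).
  have -> : pmul (x : pt G R) z = pmul (pmul (x : pt G R) y) (inr \o g : pt G R).
    by rewrite pmul_nat pinv_nat pmulA -(pmulA x) pmulgV pmulg1.
  rewrite aE mulr_sumr; apply: eq_bigr => i' _; rewrite b'E rmorphM mulrA //.
have xyE h : pmul (x : pt G R) y (c h) = pmul (map_pt f x) (map_pt f y) h.
  by rewrite -map_ptM.
have /choice[s sE] := fun i' => coproduct_exists (b' i').
exists (\sum_i' \sum_(t <- s i') (nu (y0 (c t.2) * g (v i')) : k) *: t.1).
transitivity (Phi (\sum_i' pmul (x : pt G R) y (c (b' i')) * inr (g (v i')))).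
  rewrite (linear_bigsum Phil) linear_sum; apply: eq_bigr => i' _.
  rewrite xyE sE mulr_suml (linear_bigsum Phil) linear_sum; apply: eq_bigr => t _ /=.
  by rewrite linearZ -mulrA -rmorphM PhiE.
rewrite -E xyE bE aE big_distrlr (linear_bigsum Phil) /= (bigD1 j) //= [X in _ + X]big1 ?addr0.
  rewrite (linear_bigsum Phil) (bigD1 i) //= [X in _ + X]big1 ?addr0.
    by rewrite mulrACA -!rmorphM PhiE nuE rhoK muq lv !eqxx mulr1 scale1r.
  move=> i' /negbTE ii'; rewrite mulrACA -!rmorphM PhiE nuE lv eq_sym ii' mulr0.
  exact: scale0r.
move=> j' /negbTE jj'; rewrite (linear_bigsum Phil) big1 // => i' _.
rewrite mulrACA -!rmorphM PhiE nuE rhoK muq eq_sym jj' mul0r.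
exact: scale0r.
Qed.

(** Let b <> 0 be in the conductor.  From b = sum_j e(p_j) q_j, with e the counit,
    some p_j has e(p_j) <> 0; it is in the conductor, and so are the left factors
    of its own coproduct.  Since e(p_j) = sum p'_i S(q'_i), with S the antipode,
    and the conductor is an ideal of B, the nonzero scalar e(p_j) is in it. *)
Lemma conductor_full : conductor 1.
Proof.
have Jsum (I : finType) (F : I -> B) : (forall i, conductor (F i)) -> conductor (\sum_i F i).
  move=> JF i; have /choice[b bE] := fun j => JF j i.
  exists (\sum_j b j); rewrite !rmorph_sum mulr_suml.
  by apply: eq_bigr => j _ /=; rewrite bE.
have JM b b' : conductor b -> conductor (b * b').
  move=> Jb i; have [d dE] := Jb i; exists (d * b').
  by rewrite !rmorphM /= dE mulrAC.
have [b [b0 Jb]] := common_denominator u.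
have [m [p [q [mu [dual' bE]]]]] := reduced_coproduct b.
have Jp := conductor_translate dual' bE Jb.
have [j pj] : exists j, counit H (p j) != 0.
  apply: contrapT => no; move/eqP: b0; apply.
  have := bE _ (pone H B) (idfun : pt H B); rewrite pmul1g /= => ->.
  rewrite big1 // => j _; rewrite poneE.
  have [->|e] := eqVneq (counit H (p j)) 0; last by case: no; exists j.
  by rewrite scale0r mul0r.
have [m' [p' [q' [mu' [dual'' bE']]]]] := reduced_coproduct (p j).
have Jp' := conductor_translate dual'' bE' (Jp j).
have Ju : conductor ((counit H (p j))%:A).
  rewrite -poneE -(pmulgV (idfun : pt H B)) bE'; apply: Jsum => i.
  by apply: JM; apply: Jp'.
have -> : (1 : B) = (counit H (p j))%:A * (counit H (p j))^-1%:A.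
  by rewrite -scalerAl mul1r scalerA divff // scale1r.
exact: JM.
Qed.

End Conductor.

Lemma trivial_kernel_surjective (a : A) : exists b, c b = a.
Proof.
have [n [u [v [l [dual aE]]]]] := reduced_coproduct a.
have /choice[b bE] := conductor_full dual aE.
exists (\sum_i counit G (v i) *: b i).
have := aE _ (idfun : pt G A) (pone G A); rewrite pmulg1 /= => ->.
rewrite rmorph_sum; apply: eq_bigr => i _ /=.
by rewrite linearZ /= bE rmorph1 mul1r poneE -scalerAr mulr1.
Qed.

End TrivialKernel.

(** * Pro-C-groups as groups covered by their quotients in C *)

Lemma hom_factor_range (k : fieldType) (G H1 H2 : progroup k) (f1 : pghom G H1)
    (f2 : pghom G H2) : epi f2 -> range (comap f1) `<=` range (comap f2) ->
  exists g : pghom H2 H1, hom_eq (comp_hom g f2) f1.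
Proof.
move=> e2 sub; apply: hom_factor => // a.
by have [|b _ bE] := sub (comap f1 a); [exists a|exists b].
Qed.

Lemma epi_comp (k : fieldType) (G H K : progroup k) (g : pghom H K) (f : pghom G H) :
  epi g -> epi f -> epi (comp_hom g f).
Proof. by move=> eg ef a b /= /ef /eg. Qed.

Lemma epi_factor (k : fieldType) (G H K : progroup k) (g : pghom H K) (f : pghom G H)
    (h : pghom G K) : hom_eq (comp_hom g f) h -> epi h -> epi g.
Proof. by move=> E eh a b ab; apply: eh; rewrite -!E /= ab. Qed.

Lemma subalgebra_preimage (k : fieldType) (A B : comAlgType k) (f : {lrmorphism A -> B})
    (S : set B) : subalgebra S -> subalgebra (f @^-1` S).
Proof.
case=> S1 Sl SM; split=> [|c u v Su Sv|u v Su Sv] /=.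
- by rewrite rmorph1.
- by rewrite linearP; apply: Sl.
- by rewrite rmorphM; apply: SM.
Qed.

Lemma subalgebra_range (k : fieldType) (A B : comAlgType k) (f : {lrmorphism A -> B}) :
  subalgebra (range f).
Proof.
split=> [|c _ _ [u _ <-] [v _ <-]|_ _ [u _ <-] [v _ <-]].
- by exists 1; rewrite ?rmorph1.
- by exists (c *: u + v); rewrite ?linearP.
- by exists (u * v); rewrite ?rmorphM.
Qed.

Lemma range_sub_fg (k : fieldType) (A B : comAlgType k) (f : {lrmorphism A -> B})
    (S : set B) (s : seq A) :
  (forall D : set A, subalgebra D -> (forall a, a \in s -> D a) -> D = setT) ->
  subalgebra S -> (forall a, a \in s -> S (f a)) -> range f `<=` S.
Proof.
move=> gen sS sub _ [a _ <-].
by have -> : S (f a) = (f @^-1` S) a by []; rewrite (gen (f @^-1` S)) //; apply: subalgebra_preimage.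
Qed.

Lemma range_alg_span (k : fieldType) (A B : comAlgType k) (f : {lrmorphism A -> B})
    (s : seq A) :
  (forall D : set A, subalgebra D -> (forall a, a \in s -> D a) -> D = setT) ->
  range f = alg_span [set b | b \in map f s].
Proof.
move=> gen; apply/seteqP; split.
  apply: range_sub_fg gen (subalgebra_span _) _ => a sa.
  by apply: sub_alg_span; rewrite /= map_f.
apply: alg_span_min; first exact: subalgebra_range.
by move=> _ /mapP[a _ ->]; exists a.
Qed.

Section ProGroups.
Variables (k : fieldType) (C : progroup k -> Prop).
Implicit Types G H X : progroup k.

(** This is the form in which pro-C is used: unlike the existence of a projective
    system, it speaks about the ring of H alone, and it is easily inherited by
    unions and composita. *)
Definition covered H : Prop := forall F : seq (coordring H),
  exists (X : progroup k) (q : pghom H X),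
    [/\ C X, epi q & forall a, a \in F -> range (comap q) a].

Section Limit.
Variables (I : Type) (le : I -> I -> Prop) (X : I -> progroup k).
Variables (t : forall i j, le i j -> pghom (X j) (X i)) (G : progroup k).
Variable p : forall i, pghom G (X i).
Hypotheses (dir : directed le) (sys : projective_system t).
Hypotheses (t_epi : forall i j (h : le i j), epi (t h)) (lim : projective_limit t p).

Lemma limit_tp i j (h : le i j) a : comap (p j) (comap (t h) a) = comap (p i) a.
Proof. by case: lim => tp _; apply: (tp i j h). Qed.

(** The embeddings of the k[X_i] into the reduced product form a compatible family
    of points, so they factor through k[G]. *)
Lemma limit_proj_epi i : epi (p i).
Proof.
have [tid tcomp] := sys; have [_ univ] := lim.
have [||M [x [xinj xt]]] := @reduced_product k I le (fun i => coordring (X i))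
  (fun i j h => comap (t h)) dir _ _ t_epi.
- exact: tid.
- by move=> i' j l hij hjl hil a; apply: tcomp.
have [|y [yE _]] := univ M x.
  by move=> i' j h; apply: lrmorph_ext; apply: xt.
move=> a b ab; apply: (xinj i).
by rewrite -!(yE i) /= ab.
Qed.

(** The union of the images of the k[X_i] is a subalgebra of k[G] that already
    receives all of them.  By the universal property k[G] maps to it, and the
    composite with the inclusion is the identity. *)
Lemma limit_range a : exists i, range (comap (p i)) a.
Proof.
have [_ univ] := lim; have [[i0] lexx letr ledir] := dir.
pose S := [set a | exists i, range (comap (p i)) a].
have up i j (b : coordring (X i)) : le i j -> range (comap (p j)) (comap (p i) b).
  by move=> h; exists (comap (t h) b) => //; rewrite limit_tp.
have two b b' : S b -> S b' -> exists l, range (comap (p l)) b /\ range (comap (p l)) b'.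
  move=> [i [u _ <-]] [j [v _ <-]]; have [l il jl] := ledir i j.
  by exists l; split; apply: up.
have sS : subalgebra S.
  split=> [|c u v Su Sv|u v Su Sv].
  - by exists i0; have [] := subalgebra_range (comap (p i0)).
  - have [l [ul vl]] := two _ _ Su Sv; exists l.
    by have [_ Sl _] := subalgebra_range (comap (p l)); apply: Sl.
  - have [l [ul vl]] := two _ _ Su Sv; exists l.
    by have [_ _ SM] := subalgebra_range (comap (p l)); apply: SM.
have [R [v [vinj vE]]] := subalgebra_carrier sS.
have Hx i : exists x : {lrmorphism coordring (X i) -> R}, forall b, v (x b) = comap (p i) b.
  have /choice[x xE] : forall b : coordring (X i), exists r, v r = comap (p i) b.
    by move=> b; apply/vE; exists i, b.
  have [|||x' x'E] := @lrmorphism_intro k _ _ x.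
  - by apply: vinj; rewrite xE !rmorph1.
  - by move=> d b b'; apply: vinj; rewrite linearP /= !xE linearP.
  - by move=> b b'; apply: vinj; rewrite rmorphM /= !xE rmorphM.
  by exists x' => b; rewrite x'E.
pose x i := projT1 (cid (Hx i)).
have xE i b : v (x i b) = comap (p i) b by rewrite /x; case: cid.
have [|y [yE _]] := univ R x.
  by move=> i j h; apply: lrmorph_ext => b; apply: vinj; rewrite /= !xE limit_tp.
have [|z [_ zuniq]] := univ _ (fun i => comap (p i)).
  by move=> i j h; apply: lrmorph_ext => b; rewrite /= limit_tp.
have E1 : z = (v \o y : pt G (coordring G)).
  apply: zuniq => i; apply: lrmorph_ext => b /=.
  rewrite -[RHS]xE; congr (v _).
  exact: (congr1 (fun x : pt (X i) R => x b) (yE i)).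
have E2 : z = idfun by apply: zuniq => i; apply: lrmorph_ext.
suff -> : a = v (y a) by apply/vE; exists (y a).
by rewrite -[LHS](congr1 (fun x : pt G _ => x a) (etrans (esym E1) E2)).
Qed.

Lemma limit_range_seq (F : seq (coordring G)) :
  exists i, forall a, a \in F -> range (comap (p i)) a.
Proof.
have [[i0] lexx letr ledir] := dir.
elim: F => [|a F [i Fi]]; first by exists i0.
have [j [b _ ab]] := limit_range a; have [l il jl] := ledir i j.
exists l => a'; rewrite inE => /orP[/eqP ->|/Fi[b' _ <-]].
  by exists (comap (t jl) b) => //; rewrite limit_tp.
by exists (comap (t il) b') => //; rewrite limit_tp.
Qed.

End Limit.

Lemma pro_covered G : pro C G -> covered G.
Proof.
move=> [I [le [X [t [p [dir CX sys tepi lim]]]]]] F.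
have [i Fi] := limit_range_seq dir lim F.
by exists (X i), (p i); split=> //; apply: (limit_proj_epi dir sys tepi lim).
Qed.

Hypothesis fC : formation C.

(** The projective system is indexed by the images in k[G] of the rings of the
    quotients in C, ordered by inclusion.  It is directed since these images are
    finitely generated, and its limit is G since they cover k[G].  Images, rather
    than quotient maps, serve as indices because they form a small type. *)
Lemma covered_pro G : covered G -> pro C G.
Proof.
move=> cov.
pose image (B : set (coordring G)) := exists (X : progroup k) (q : pghom G X),
  [/\ C X, epi q & range (comap q) = B].
pose I := {B | image B}.
pose X (i : I) := projT1 (cid (svalP i)).
pose p (i : I) : pghom G (X i) := projT1 (cid (projT2 (cid (svalP i)))).
have pP i : [/\ C (X i), epi (p i) & range (comap (p i)) = sval i].
  exact: (projT2 (cid (projT2 (cid (svalP i))))).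
pose le (i j : I) := range (comap (p i)) `<=` range (comap (p j)).
have pepi i : epi (p i) by have [] := pP i.
have tP i j (h : le i j) : {g | hom_eq (comp_hom g (p j)) (p i)}.
  by apply/cid; apply: hom_factor_range (pepi j) h.
pose t i j (h : le i j) := sval (tP i j h).
have tE i j (h : le i j) a : comap (p j) (comap (t i j h) a) = comap (p i) a.
  by rewrite /t; case: (tP i j h) => g gE; apply: gE.
have gens i : exists s : seq (coordring G), forall S, subalgebra S ->
    (forall a, a \in s -> S a) -> range (comap (p i)) `<=` S.
  have [CX _ _] := pP i; have [s sgen] := formation_algebraic fC CX.
  exists (map (comap (p i)) s) => S sS sub.
  by apply: range_sub_fg sgen sS _ => a sa; apply/sub/map_f.
have cover (F : seq (coordring G)) : exists i : I, forall a, a \in F -> range (comap (p i)) a.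
  have [Y [q [CY eq qF]]] := cov F.
  have w : image (range (comap q)) by exists Y, q.
  exists (exist image _ w); have [_ _ E] := pP (exist image _ w).
  by move=> a aF; apply: (eq_ind_r (fun S => S a) (qF a aF) E).
have dir : directed le.
  split; first by have [i _] := cover [::].
  - by move=> i.
  - by move=> i j l; apply: subset_trans.
  - move=> i j; have [s si] := gens i; have [r rj] := gens j.
    have [l lP] := cover (s ++ r).
    have sl := subalgebra_range (comap (p l)).
    exists l; [apply: si sl _ => a ha|apply: rj sl _ => a ha];
      by apply: lP; rewrite mem_cat ha ?orbT.
exists I, le, X, t, p; split=> //.
- by move=> i; have [] := pP i.
- split=> [i h a|i j l hij hjl hil a] /=.
    by apply: (pepi i); rewrite tE.
  by apply: (pepi l); rewrite !tE.
- by move=> i j h a b ab; apply: (pepi i); rewrite -!(tE i j h) ab.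
split=> [i j h a /=|R x xt]; first by rewrite tE.
have xtE i j (h : le i j) a : x j (comap (t i j h) a) = x i a.
  exact: (congr1 (fun y : pt (X i) R => y a) (xt i j h)).
have wd i j a b : comap (p i) a = comap (p j) b -> x i a = x j b.
  have [_ _ _ /(_ i j)[l il jl]] := dir; rewrite -(tE i l il) -(tE j l jl).
  by move=> /(pepi l) E; rewrite -(xtE i l il) -(xtE j l jl) E.
have cov2 a b : exists i, range (comap (p i)) a /\ range (comap (p i)) b.
  have [i iP] := cover [:: a; b].
  by exists i; split; apply: iP; rewrite !inE eqxx ?orbT.
have /choice[y yE] : forall a, exists r, forall i b, comap (p i) b = a -> x i b = r.
  move=> a; have [i [[b _ <-] _]] := cov2 a a.
  by exists (x i b) => j b' /wd.
have {}yE i b : y (comap (p i) b) = x i b by rewrite -(yE _ i b).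
have [|||z zE] := @lrmorphism_intro k _ _ y.
- by have [i _] := cov2 1 1; rewrite -(rmorph1 (comap (p i))) yE rmorph1.
- move=> c a b; have [i [[a' _ <-] [b' _ <-]]] := cov2 a b.
  by rewrite -linearP !yE linearP.
- move=> a b; have [i [[a' _ <-] [b' _ <-]]] := cov2 a b.
  by rewrite -rmorphM !yE rmorphM.
exists z; split=> [i|z' z'E]; first by apply: lrmorph_ext => b /=; rewrite zE yE.
apply: lrmorph_ext => a; have [i [[b _ <-] _]] := cov2 a a.
by rewrite zE yE -(z'E i).
Qed.

End ProGroups.

(** * Quotients of a pair of groups as Hopf relations *)

Section CoproductClosure.
Variables (k : fieldType) (G : progroup k).
Local Notation A := (coordring G).
Implicit Types s t : seq (A * A).

Lemma coproduct_1 : coproduct (1 : A) [:: (1, 1)].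
Proof. by move=> R x y; rewrite big_seq1 !rmorph1 mulr1. Qed.

Lemma coproduct_lin (c : k) (a b : A) s t : coproduct a s -> coproduct b t ->
  coproduct (c *: a + b) ([seq (c *: p.1, p.2) | p <- s] ++ t).
Proof.
move=> sa tb R x y; rewrite linearP /= sa tb big_cat big_map scaler_sumr; congr (_ + _).
by apply: eq_bigr => p _; rewrite linearZ /= scalerAl.
Qed.

Lemma coproduct_mul (a b : A) s t : coproduct a s -> coproduct b t ->
  coproduct (a * b) [seq (p.1 * q.1, p.2 * q.2) | p <- s, q <- t].
Proof.
move=> sa tb R x y; rewrite rmorphM /= sa tb big_allpairs_dep big_distrlr /=.
apply: eq_bigr => p _; apply: eq_bigr => q _.
by rewrite !rmorphM mulrACA.
Qed.

End CoproductClosure.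

(** A subalgebra Q of k[G], embedded by c, on which the coproduct of k[G] can be
    written with factors in Q and which is stable under the antipode, is the ring of
    a quotient of G. *)
Section SubgroupRing.
Variables (k : fieldType) (G : progroup k) (Q : comAlgType k).
Variables (c : {lrmorphism Q -> coordring G}) (delta : Q -> seq (Q * Q)) (S : Q -> Q).
Hypothesis c_inj : injective c.
Let cc (p : Q * Q) := (c p.1, c p.2).
Hypothesis deltaP : forall r, coproduct (c r) (map cc (delta r)).
Hypothesis SP : forall r, c (S r) = antipode G (c r).

(** The product of two points of Q.  Its value does not depend on how a coproduct is
    written, by bilinear detection in k[G] with x and y composed with a linear
    retraction rho onto Q; hence it can be computed from whichever expression
    is convenient, and it is multiplicative. *)
Lemma convolution_exists (R : comAlgType k) (x y : {lrmorphism Q -> R}) :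
  exists z : {lrmorphism Q -> R}, forall r s, coproduct (c r) (map cc s) ->
    z r = \sum_(p <- s) x p.1 * y p.2.
Proof.
have [rho [rhol rhoK]] := linear_left_inverse (linearP c) c_inj.
have lin (z : {lrmorphism Q -> R}) : linear (z \o rho).
  by move=> d u v; rewrite /= rhol linearP.
have wd r s : coproduct (c r) (map cc s) ->
    \sum_(p <- delta r) x p.1 * y p.2 = \sum_(p <- s) x p.1 * y p.2.
  move=> sE; suff E t : \sum_(p <- t) x p.1 * y p.2 =
      \sum_(p <- map cc t) (x \o rho) p.1 * (y \o rho) p.2.
    rewrite !E; apply: bilinear_detection (linear_mul2 (lin x) (lin y)) => T x' y'.
    by rewrite -(deltaP r (x' : pt G T)) -(sE T).
  by rewrite big_map; apply: eq_bigr => p _; rewrite /= !rhoK.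
have [|||z zE] := @lrmorphism_intro k Q R (fun r => \sum_(p <- delta r) x p.1 * y p.2).
- rewrite (wd 1 [:: (1, 1)]) ?big_seq1 ?rmorph1 ?mulr1 //=.
  by rewrite /cc /= rmorph1; apply: coproduct_1.
- move=> d a b; rewrite (wd (d *: a + b) ([seq (d *: p.1, p.2) | p <- delta a] ++ delta b)).
    rewrite big_cat big_map scaler_sumr; congr (_ + _).
    by apply: eq_bigr => p _; rewrite linearZ /= scalerAl.
  rewrite linearP map_cat; have := coproduct_lin d (deltaP a) (deltaP b).
  rewrite -!map_comp; set s1 := map _ _; set s2 := map _ (delta a).
  suff -> : s1 = s2 by [].
  by apply: eq_map => p; rewrite /cc /= linearZ.
- move=> a b.
  rewrite (wd (a * b) [seq (p.1 * q.1, p.2 * q.2) | p <- delta a, q <- delta b]).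
    rewrite big_allpairs_dep big_distrlr /=.
    by apply: eq_bigr => p _; apply: eq_bigr => q _; rewrite !rmorphM mulrACA.
  have ccM : map cc [seq (p.1 * q.1, p.2 * q.2) | p <- delta a, q <- delta b] =
      [seq (p.1 * q.1, p.2 * q.2) | p <- map cc (delta a), q <- map cc (delta b)].
    rewrite allpairs_mapl allpairs_mapr map_allpairs.
    by apply: eq_allpairs => // p q; rewrite /cc /= !rmorphM.
  by rewrite rmorphM ccM; apply: (coproduct_mul (deltaP a) (deltaP b)).
by exists z => r s /wd <-; rewrite zE.
Qed.

(** The maps e and e' identify k[H] with Q; the coproduct of H is then given by the
    chosen expressions delta, and this makes it possible to compare H with quotients
    of other groups. *)
Lemma subgroup_ring : exists (H : progroup k) (f : pghom G H)
    (e : {lrmorphism coordring H -> Q}) (e' : Q -> coordring H),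
  [/\ cancel e e', cancel e' e, comap f =1 c \o e
    & forall (R : comAlgType k) (x y : pt H R) h,
        pmul x y h = \sum_(p <- delta (e h)) x (e' p.1) * y (e' p.2)].
Proof.
have [rho [rhol rhoK]] := linear_left_inverse (linearP c) c_inj.
have [|||S' S'E] := @lrmorphism_intro k Q Q S.
- by apply: c_inj; rewrite SP !rmorph1.
- by move=> d a b; apply: c_inj; rewrite SP !linearP /= !SP.
- by move=> a b; apply: c_inj; rewrite SP !rmorphM /= !SP.
pose one (R : comAlgType k) : {lrmorphism Q -> R} := pone G R \o c.
pose inv (R : comAlgType k) (x : {lrmorphism Q -> R}) : {lrmorphism Q -> R} := x \o S'.
pose mul (R : comAlgType k) (x y : {lrmorphism Q -> R}) :=
  projT1 (cid (convolution_exists x y)).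
have mulE (R : comAlgType k) (x y : {lrmorphism Q -> R}) r :
    mul R x y r = \sum_(p <- delta r) x p.1 * y p.2.
  by rewrite /mul; case: cid => z /= zE; apply: zE.
have mulA (R : comAlgType k) (x y z : {lrmorphism Q -> R}) :
    mul R x (mul R y z) = mul R (mul R x y) z.
  apply: lrmorph_ext => r; rewrite !mulE.
  have lin (w : {lrmorphism Q -> R}) : linear (w \o rho).
    by move=> d u v; rewrite /= rhol linearP.
  pose s1 := [seq (c p.1, (c q.1, c q.2)) | p <- delta r, q <- delta p.2].
  pose s2 := [seq (c q.1, (c q.2, c p.2)) | p <- delta r, q <- delta p.1].
  have e1 : \sum_(p <- delta r) x p.1 * mul R y z p.2 =
      \sum_(p <- s1) (x \o rho) p.1 * ((y \o rho) p.2.1 * (z \o rho) p.2.2).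
    rewrite big_allpairs_dep; apply: eq_bigr => p _; rewrite mulE mulr_sumr.
    by apply: eq_bigr => q _; rewrite /= !rhoK.
  have e2 : \sum_(p <- delta r) mul R x y p.1 * z p.2 =
      \sum_(p <- s2) (x \o rho) p.1 * ((y \o rho) p.2.1 * (z \o rho) p.2.2).
    rewrite big_allpairs_dep; apply: eq_bigr => p _; rewrite mulE mulr_suml.
    by apply: eq_bigr => q _; rewrite /= !rhoK mulrA.
  rewrite e1 e2; apply: trilinear_detection (lin x) (lin y) (lin z) => T x' y' z'.
  rewrite !big_allpairs_dep /=.
  have := congr1 (fun w : pt G T => w (c r)) (pmulA (x' : pt G T) y' z').
  rewrite !deltaP !big_map /= => E; apply: etrans (etrans _ E) _.
    apply: eq_bigr => p _; rewrite deltaP big_map mulr_sumr.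
    by apply: eq_bigr.
  apply: eq_bigr => p _; rewrite deltaP big_map mulr_suml.
  by apply: eq_bigr => q _; rewrite mulrA.
have mul1 (R : comAlgType k) (x : {lrmorphism Q -> R}) : mul R (one R) x = x.
  apply: lrmorph_ext => r; rewrite mulE.
  transitivity (x (\sum_(p <- delta r) counit G (c p.1) *: p.2)).
    rewrite rmorph_sum; apply: eq_bigr => p _.
    by rewrite /one /= poneE -scalerAl mul1r linearZ.
  congr (x _); apply: c_inj.
  have /(congr1 (fun w : pt G _ => w (c r))) := pmul1g (idfun : pt G (coordring G)).
  rewrite deltaP big_map /= => <-; rewrite rmorph_sum; apply: eq_bigr => p _ /=.
  by rewrite linearZ /= poneE -scalerAl mul1r.
have mulV (R : comAlgType k) (x : {lrmorphism Q -> R}) : mul R (inv R x) x = one R.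
  apply: lrmorph_ext => r; rewrite mulE.
  transitivity (x (\sum_(p <- delta r) S p.1 * p.2)).
    rewrite rmorph_sum; apply: eq_bigr => p _.
    by rewrite /inv /= S'E rmorphM.
  transitivity (x (counit G (c r))%:A); last first.
    by rewrite /one /= poneE linearZ /= rmorph1.
  congr (x _); apply: c_inj.
  rewrite linearZ /= rmorph1 -poneE -(pmulVg (idfun : pt G (coordring G))).
  rewrite deltaP big_map rmorph_sum; apply: eq_bigr => p _ /=.
  by rewrite rmorphM /= SP.
have mul_nat (R T : comAlgType k) (h : {lrmorphism R -> T}) (x y : {lrmorphism Q -> R}) :
    (h \o mul R x y : {lrmorphism Q -> T}) = mul T (h \o x) (h \o y).
  apply: lrmorph_ext => r; rewrite /= !mulE rmorph_sum.
  by apply: eq_bigr => p _; rewrite rmorphM.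
pose H := @ProGroup k Q one inv mul mulA mul1 mulV mul_nat.
pose cH : {lrmorphism coordring H -> coordring G} := c.
have cM (R : comAlgType k) (x y : pt G R) :
    comap_pt cH (pmul x y) = pmul (comap_pt cH x) (comap_pt cH y).
  apply: lrmorph_ext => r; rewrite /= deltaP big_map [RHS]mulE.
  by apply: eq_bigr.
by exists H, (Hom cM), idfun, idfun; split=> // R x y h; rewrite /= mulE.
Qed.

End SubgroupRing.

Section HopfRelations.
Variables (k : fieldType) (G G' : progroup k).
Local Notation A := (coordring G).
Local Notation A' := (coordring G').
Local Notation AA := (A * A')%type.

(** The intrinsic properties of the graph of a common quotient: a partial isomorphism
    of algebras which respects antipodes and coproducts.  The factors of both
    coproducts are paired by the relation itself. *)
Definition hopf_relation (S : set AA) : Prop :=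
  [/\ subalgebra S,
      (forall p, S p -> p.1 = 0 -> p.2 = 0) /\ (forall p, S p -> p.2 = 0 -> p.1 = 0),
      (forall p, S p -> S (antipode G p.1, antipode G' p.2))
    & forall p, S p -> exists s : seq (AA * AA),
        [/\ forall q, q \in s -> S q.1 /\ S q.2,
            coproduct p.1 [seq (q.1.1, q.2.1) | q <- s]
          & coproduct p.2 [seq (q.1.2, q.2.2) | q <- s]]].

Definition graph H (f : pghom G H) (f' : pghom G' H) : set AA :=
  range (fun h => (comap f h, comap f' h)).

Lemma graph_hopf_relation H (f : pghom G H) (f' : pghom G' H) :
  epi f -> epi f' -> hopf_relation (graph f f').
Proof.
move=> ef ef'; split.
- split=> [|d _ _ [u _ <-] [v _ <-]|_ _ [u _ <-] [v _ <-]].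
  + by exists 1; rewrite ?rmorph1.
  + by exists (d *: u + v); rewrite ?linearP.
  + by exists (u * v); rewrite ?rmorphM.
- split=> _ [h _ <-] /= E.
    by rewrite (_ : h = 0) ?rmorph0 //; apply: ef; rewrite E rmorph0.
  by rewrite (_ : h = 0) ?rmorph0 //; apply: ef'; rewrite E rmorph0.
- by move=> _ [h _ <-]; exists (antipode H h); rewrite ?comap_antipode.
move=> _ [h _ <-]; have [s sE] := coproduct_exists h.
exists [seq ((comap f q.1, comap f' q.1), (comap f q.2, comap f' q.2)) | q <- s]; split.
- by move=> _ /mapP[q _ ->] /=; split; [exists q.1|exists q.2].
- move=> R x y; rewrite -!map_comp big_map /=.
  have /= <- := sE R (map_pt f x) (map_pt f y).
  by rewrite -map_ptM.
- move=> R x y; rewrite -!map_comp big_map /=.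
  have /= <- := sE R (map_pt f' x) (map_pt f' y).
  by rewrite -map_ptM.
Qed.

Lemma hopf_relation_graph S : hopf_relation S ->
  exists (H : progroup k) (f : pghom G H) (f' : pghom G' H),
    [/\ epi f, epi f' & graph f f' = S].
Proof.
move=> [sS [S1 S2] SV SD].
have [Q [v [vinj vE]]] := subalgebra_carrier sS.
have Sv r : S (v r) by apply/vE; exists r.
pose c : {lrmorphism Q -> A} := fst \o v.
pose c' : {lrmorphism Q -> A'} := snd \o v.
have cinj : injective c.
  move=> a b ab; apply/eqP; rewrite -subr_eq0; apply/eqP; apply: vinj; rewrite linear0.
  have ab1 : (v (a - b)).1 = 0 by rewrite linearB /= [(v a).1]ab subrr.
  by rewrite [LHS]surjective_pairing (S1 _ _ ab1) ?ab1.
have c'inj : injective c'.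
  move=> a b ab; apply/eqP; rewrite -subr_eq0; apply/eqP; apply: vinj; rewrite linear0.
  have ab2 : (v (a - b)).2 = 0 by rewrite linearB /= [(v a).2]ab subrr.
  by rewrite [LHS]surjective_pairing (S2 _ _ ab2) ?ab2.
have /choice[an anE] : forall r, exists r', v r' = (antipode G (c r), antipode G' (c' r)).
  by move=> r; apply/vE/SV/Sv.
have /choice[delta deltaP] : forall r, exists s : seq (Q * Q),
    coproduct (c r) [seq (c q.1, c q.2) | q <- s] /\
    coproduct (c' r) [seq (c' q.1, c' q.2) | q <- s].
  move=> r; have [s [sS' s1 s2]] := SD _ (Sv r).
  have [t tE] : exists t : seq (Q * Q), s = [seq (v q.1, v q.2) | q <- t].
    elim: s sS' {s1 s2} => [|q s IHs] sS'; first by exists [::].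
    have [|t ->] := IHs; first by move=> q' q's; apply: sS'; rewrite inE q's orbT.
    have [/vE[r1 E1] /vE[r2 E2]] := sS' q (mem_head _ _).
    by exists ((r1, r2) :: t); rewrite /= E1 E2 -surjective_pairing.
  by exists t; split; [move: s1|move: s2]; rewrite tE -map_comp.
have [||H [f [e [e' [eK e'K fE pmulE]]]]] := @subgroup_ring k G Q c delta an cinj.
- by move=> r; have [] := deltaP r.
- by move=> r; rewrite /= anE.
have fM (R : comAlgType k) (x y : pt G' R) :
    comap_pt (c' \o e : {lrmorphism coordring H -> A'}) (pmul x y) =
    pmul (comap_pt (c' \o e) x) (comap_pt (c' \o e) y).
  apply: lrmorph_ext => h; rewrite pmulE [LHS](deltaP (e h)).2 big_map.
  by apply: eq_bigr => p _; rewrite /= !e'K.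
exists H, f, (Hom fM); split.
- by move=> a b; rewrite !fE => /cinj /(can_inj eK).
- by move=> a b /= /c'inj /(can_inj eK).
apply/seteqP; split=> [_ [h _ <-]|p /vE[r <-]].
  by rewrite /= fE /= -surjective_pairing.
by exists (e' r) => //; rewrite /= fE /= e'K -surjective_pairing.
Qed.

End HopfRelations.

(** * Composita of quotients *)

Lemma seq_choice (T U : eqType) (P : T -> U -> Prop) (F : seq T) :
  (forall a, a \in F -> exists b, P a b) ->
  exists E : seq U, (forall a, a \in F -> exists2 b, b \in E & P a b) /\
    (forall b, b \in E -> exists2 a, a \in F & P a b).
Proof.
elim: F => [|a F IHF] h; first by exists [::].
have [|E [E1 E2]] := IHF; first by move=> a' a'F; apply: h; rewrite inE a'F orbT.
have [b ab] := h a (mem_head _ _); exists (b :: E); split=> [a'|b'].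
  rewrite inE => /orP[/eqP ->|/E1[b' b'E a'b']]; first by exists b; rewrite ?mem_head.
  by exists b'; rewrite // inE b'E orbT.
rewrite inE => /orP[/eqP ->|/E2[a' a'F a'b']]; first by exists a; rewrite ?mem_head.
by exists a'; rewrite // inE a'F orbT.
Qed.

(** The elements generated by Y and finitely many members of X form a subalgebra, since
    the finite lists involved can be concatenated. *)
Lemma alg_span_finite (k : fieldType) (A : comAlgType k) (X Y : set A) (F : seq A) :
  (forall a, a \in F -> alg_span (X `|` Y) a) ->
  exists s : seq A, (forall b, b \in s -> X b) /\
    forall a, a \in F -> alg_span ([set b | b \in s] `|` Y) a.
Proof.
have mono (s t : seq A) : {subset s <= t} ->
    alg_span ([set b | b \in s] `|` Y) `<=` alg_span ([set b | b \in t] `|` Y).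
  by move=> st; apply: alg_span_mono => b [/st|]; [left|right].
have one a : alg_span (X `|` Y) a ->
    exists s : seq A, (forall b, b \in s -> X b) /\ alg_span ([set b | b \in s] `|` Y) a.
  move=> ha; apply: (ha [set a | exists s : seq A,
    (forall b, b \in s -> X b) /\ alg_span ([set b | b \in s] `|` Y) a]); last first.
    move=> b [Xb|Yb]; last by exists [::]; split=> //; apply: sub_alg_span; right.
    exists [:: b]; split; first by move=> b'; rewrite inE => /eqP ->.
    by apply: sub_alg_span; left; rewrite /= mem_head.
  have join (s t : seq A) : (forall b, b \in s -> X b) -> (forall b, b \in t -> X b) ->
      forall b, b \in s ++ t -> X b.
    by move=> sX tX b; rewrite mem_cat => /orP[/sX|/tX].
  have inl (s t : seq A) : {subset s <= s ++ t} by move=> b; rewrite mem_cat => ->.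
  have inr (s t : seq A) : {subset t <= s ++ t}.
    by move=> b; rewrite mem_cat orbC => ->.
  have sp (s : seq A) : subalgebra (alg_span ([set b | b \in s] `|` Y)) by apply: subalgebra_span.
  split=> [|c u v [s [sX us]] [t [tX vt]]|u v [s [sX us]] [t [tX vt]]].
  - by exists [::]; split=> //; case: (sp [::]).
  - exists (s ++ t); split; first exact: join.
    by have [_ spl _] := sp (s ++ t); apply: spl; [apply: mono us|apply: mono vt].
  - exists (s ++ t); split; first exact: join.
    by have [_ _ spM] := sp (s ++ t); apply: spM; [apply: mono us|apply: mono vt].
elim: F => [|a F IHF] h; first by exists [::].
have [|s [sX sF]] := IHF; first by move=> b bF; apply: h; rewrite inE bF orbT.
have [t [tX ta]] := one a (h a (mem_head _ _)).
exists (t ++ s); split=> b; first by rewrite mem_cat => /orP[/tX|/sX].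
rewrite inE => /orP[/eqP ->|/sF].
  by apply: mono ta => c; rewrite mem_cat => ->.
by apply: mono => c; rewrite mem_cat orbC => ->.
Qed.

Lemma alg_span_map (k : fieldType) (A B : comAlgType k) (f : {lrmorphism A -> B})
    (X : set A) (Y : set B) : (forall a, X a -> alg_span Y (f a)) ->
  forall a, alg_span X a -> alg_span Y (f a).
Proof.
move=> XY a ha; apply: (ha (f @^-1` alg_span Y)) => //.
exact: subalgebra_preimage (subalgebra_span Y).
Qed.

Lemma alg_span_idem (k : fieldType) (A : comAlgType k) (X Y : set A) :
  X `<=` alg_span Y -> alg_span X `<=` alg_span Y.
Proof. by apply: alg_span_min; apply: subalgebra_span. Qed.

Section Compositum.
Variables (k : fieldType) (G : progroup k).
Local Notation A := (coordring G).

(** The functions whose antipode and coproduct can be written inside the subalgebra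
    generated by the two rings form a subalgebra that contains both rings, so the
    generated subalgebra is a Hopf subalgebra. *)
Lemma compositum H1 H2 (f1 : pghom G H1) (f2 : pghom G H2) :
  exists (H : progroup k) (f : pghom G H),
    epi f /\ range (comap f) = alg_span (range (comap f1) `|` range (comap f2)).
Proof.
set X := _ `|` _; set B := alg_span X.
have sB : subalgebra B by apply: subalgebra_span.
pose good (a : A) := B (antipode G a) /\
  exists s, (forall q, q \in s -> B q.1 /\ B q.2) /\ coproduct a s.
have range_good H (f : pghom G H) : range (comap f) `<=` X -> range (comap f) `<=` good.
  move=> fX _ [h _ <-]; have fB a : B (comap f a).
    by apply: sub_alg_span; apply: fX; exists a.
  split; first by rewrite comap_antipode.
  have [s sE] := coproduct_exists h.
  exists [seq (comap f q.1, comap f q.2) | q <- s]; split.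
    by move=> _ /mapP[q _ ->]; split; apply: fB.
  move=> R x y; rewrite big_map /=; have /= <- := sE R (map_pt f x) (map_pt f y).
  by rewrite -map_ptM.
have sgood : subalgebra good.
  have [B1 Bl BM] := sB; split.
  - split; first by rewrite rmorph1.
    exists [:: (1, 1)]; split; last exact: coproduct_1.
    by move=> q; rewrite inE => /eqP ->.
  - move=> c u v [Su [s [sB' us]]] [Sv [t [tB vt]]]; split.
      by rewrite linearP; exact: (Bl _ _ _ Su Sv).
    exists ([seq (c *: p.1, p.2) | p <- s] ++ t); split; last exact: coproduct_lin.
    move=> q; rewrite mem_cat => /orP[/mapP[p /sB'[p1 p2] ->]|/tB //].
    by split=> //; exact: (subalgebra_Z c sB p1).
  - move=> u v [Su [s [sB' us]]] [Sv [t [tB vt]]]; split.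
      by rewrite rmorphM; exact: (BM _ _ Su Sv).
    exists [seq (p.1 * q.1, p.2 * q.2) | p <- s, q <- t].
    split; last exact: coproduct_mul.
    move=> _ /allpairsP[[p q] /= [/sB'[p1 p2] /tB[q1 q2] ->]].
    by split; [exact: (BM _ _ p1 q1)|exact: (BM _ _ p2 q2)].
have Bgood : B `<=` good.
  apply: alg_span_min => // a [fa|fa].
    by apply: range_good fa => b; left.
  by apply: range_good fa => b; right.
have [|H [f [f' [ef _ fE]]]] := @hopf_relation_graph k G G [set p | B p.1 /\ p.2 = p.1].
  have [B1 Bl BM] := sB; split.
  - split=> //=.
    + by move=> c u v [Bu uu] [Bv vv]; split; [exact: (Bl _ _ _ Bu Bv)|rewrite /= uu vv].
    + by move=> u v [Bu uu] [Bv vv]; split; [exact: (BM _ _ Bu Bv)|rewrite /= uu vv].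
  - by split=> p [_ ->].
  - by move=> p [/Bgood[Bp _] pp]; rewrite /= pp.
  - move=> p [/Bgood[_ [s [sB' sp]]] pp].
    exists [seq ((q.1, q.1), (q.2, q.2)) | q <- s]; split.
    + by move=> _ /mapP[q /sB'[q1 q2] ->].
    + by rewrite -map_comp; move: sp; congr coproduct; rewrite -[LHS]map_id;
        apply: eq_map => -[].
    + rewrite -map_comp pp; move: sp; congr coproduct; rewrite -[LHS]map_id.
      by apply: eq_map => -[].
exists H, f; split=> //; apply/seteqP; split=> [_ [h _ <-]|a Ba].
  have : graph f f' (comap f h, comap f' h) by exists h.
  by rewrite fE => -[].
have : [set p | B p.1 /\ p.2 = p.1] (a, a) by split.
by rewrite -fE => -[h _ [ha _]]; exists h.
Qed.

Variable C : progroup k -> Prop.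
Hypotheses (fC : formation C) (G_cov : covered C G).

(** Finitely many generators of k[H] lie in the ring of a quotient X of G in C, which
    makes H a quotient of X. *)
Lemma fg_quotient_in_class H (f : pghom G H) (s : seq A) : epi f ->
  range (comap f) `<=` alg_span [set a | a \in s] -> C H.
Proof.
move=> ef fs; have [X [q [CX eq qs]]] := G_cov s.
have [|g gE] := @hom_factor_range k G H X f q eq.
  by apply: (subset_trans fs); apply: alg_span_min; [apply: subalgebra_range|].
by apply: (formation_quotient fC (f := g)) => //; apply: epi_factor gE ef.
Qed.

Lemma class_range_fg H X (f : pghom H X) : C X ->
  exists s : seq (coordring H), range (comap f) = alg_span [set a | a \in s].
Proof.
move=> CX; have [s gen] := formation_algebraic fC CX.
by exists (map (comap f) s); apply: range_alg_span.
Qed.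

(** Finitely many functions on K are generated by finitely many functions on H,
    which lie in the ring of a quotient Y of H in C, together with k[X].  The
    compositum of Y and X is then a finitely generated quotient of K that belongs
    to C. *)
Lemma compositum_covered H X K (f : pghom G H) (q : pghom G X) (g : pghom G K) :
  epi f -> covered C H -> C X -> epi g ->
  range (comap g) = alg_span (range (comap f) `|` range (comap q)) -> covered C K.
Proof.
move=> ef covH CX eg gE F.
have [|s [sf sF]] := @alg_span_finite k A (range (comap f)) (range (comap q))
    (map (comap g) F).
  by move=> _ /mapP[a _ ->]; rewrite -gE; exists a.
have [|F0 [F0s _]] := @seq_choice A (coordring H) (fun a b => comap f b = a) s.
  by move=> a /sf[b _ <-]; exists b.
have [Y [r [CY er rF0]]] := covH F0.
have [W [h [eh hE]]] := compositum (comp_hom r f) q.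
have [w wE] : exists w, hom_eq (comp_hom w g) h.
  apply: hom_factor_range => //; rewrite gE hE; apply: alg_span_mono.
  by move=> a [[b _ <-]|qa]; [left; exists (comap r b)|right].
have CW : C W.
  have [s1 E1] := class_range_fg (comp_hom r f) CY.
  have [s2 E2] := class_range_fg q CX.
  apply: (fg_quotient_in_class (s := s1 ++ s2) eh).
  rewrite hE; apply: alg_span_idem; rewrite E1 E2 => a [].
    by apply: alg_span_mono => b; rewrite /= mem_cat => ->.
  by apply: alg_span_mono => b; rewrite /= mem_cat orbC => ->.
exists W, w; split=> //; first exact: epi_factor wE eh.
move=> a aF; have : range (comap h) (comap g a).
  rewrite hE; have := sF _ (map_f _ aF); apply: alg_span_mono => b [/F0s[c /rF0[d _ <-] <-]|qb].
    by left; exists d.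
  by right.
by move=> [b _ E]; exists b => //; apply: eg; rewrite -E -wE.
Qed.

End Compositum.

(** * Common quotients of two groups *)

Lemma alg_span_lift (k : fieldType) (A B : comAlgType k) (f : {lrmorphism A -> B})
    (X : set B) (Y : set A) : injective f ->
  (forall x, X x -> exists2 y, alg_span Y y & f y = x) ->
  forall a, alg_span X (f a) -> alg_span Y a.
Proof.
move=> finj XY a ha.
have [Y1 Yl YM] := subalgebra_span Y.
have [||y Yy /finj <- //] := ha [set x | exists2 y, alg_span Y y & f y = x].
- split=> [|c _ _ [u Yu <-] [v Yv <-]|_ _ [u Yu <-] [v Yv <-]].
  + by exists 1; rewrite ?rmorph1.
  + by exists (c *: u + v); [exact: (Yl _ _ _ Yu Yv)|rewrite linearP].
  + by exists (u * v); [exact: (YM _ _ Yu Yv)|rewrite rmorphM].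
- by move=> x /XY.
Qed.

(** The measure of size in the induction.  Lists instead of single generators keep finitely generated rings
    finite in this measure, and the extra list absorbs the generators added within
    one step. *)
Definition generated_by (k : fieldType) (T : Type) (D : set T) (A : comAlgType k) : Prop :=
  exists (gen : T -> seq A) (L : seq A),
    forall a, alg_span [set b | b \in L \/ exists2 d, D d & b \in gen d] a.

Lemma generated_by_extend (k : fieldType) (T : Type) (D : set T) (A B : comAlgType k)
    (f : {lrmorphism A -> B}) (M : seq B) : generated_by D A ->
  (forall b, alg_span (range f `|` [set m | m \in M]) b) -> generated_by D B.
Proof.
move=> [gen [L gA]] fM; exists (fun d => map f (gen d)), (map f L ++ M) => b.
move: (fM b); apply: alg_span_idem => b' [[a _ <-]|bM]; last first.
  by apply: sub_alg_span; left; rewrite mem_cat [_ \in M]bM orbT.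
apply: alg_span_map (gA a) => c [cL|[d Dd cd]]; apply: sub_alg_span.
  by left; rewrite mem_cat map_f.
by right; exists d => //; apply: map_f.
Qed.

Lemma graph_map (k : fieldType) (G G' H : progroup k) (f : pghom G H) (f' : pghom G' H) :
  exists j : {lrmorphism coordring H -> (coordring G * coordring G')%type},
    forall h, j h = (comap f h, comap f' h).
Proof.
by apply: lrmorphism_intro => [|c a b|a b]; rewrite ?rmorph1 // ?linearP ?rmorphM.
Qed.

Section Extension.
Variables (k : fieldType) (C : progroup k -> Prop) (fC : formation C).

(** Some quotient X of G in C has L in its ring.  Saturation of G' lifts the compositum K
    of H and X to a quotient of G'; the list M consists of generators of k[X]. *)
Lemma extend_left (G G' H : progroup k) (f : pghom G H) (f' : pghom G' H)
    (L : seq (coordring G)) :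
  covered C G -> saturated C G' -> covered C H -> epi f -> epi f' -> rank_lt H G' ->
  (forall (K : progroup k) (alpha : pghom K H) (M : seq (coordring K)), covered C K ->
     (forall b, alg_span (range (comap alpha) `|` [set m | m \in M]) b) -> rank_le K G') ->
  exists (K : progroup k) (g : pghom G K) (g' : pghom G' K) (alpha : pghom K H)
      (M : seq (coordring K)),
    [/\ epi g, epi g' & covered C K] /\
    [/\ hom_eq (comp_hom alpha g) f, hom_eq (comp_hom alpha g') f',
        forall b, alg_span (range (comap alpha) `|` [set m | m \in M]) b
      & forall a, a \in L -> range (comap g) a].
Proof.
move=> Gcov [_ _ sat] Hcov ef ef' Hlt Kle.
have [X [q [CX eq qL]]] := Gcov L.
have [K [g [eg gE]]] := compositum f q.
have [alpha alphaE] : exists alpha, hom_eq (comp_hom alpha g) f.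
  by apply: hom_factor_range => //; rewrite gE => a fa; apply: sub_alg_span; left.
have [r rE] : exists r, hom_eq (comp_hom r g) q.
  by apply: hom_factor_range => //; rewrite gE => a fa; apply: sub_alg_span; right.
have Kcov : covered C K := compositum_covered fC Gcov ef Hcov CX eg gE.
have [M ME] := class_range_fg fC r CX.
have gen b : alg_span (range (comap alpha) `|` [set m | m \in M]) b.
  have : alg_span (range (comap f) `|` range (comap q)) (comap g b) by rewrite -gE; exists b.
  apply: alg_span_lift => // _ [[h _ <-]|[x _ <-]].
    by exists (comap alpha h); [apply: sub_alg_span; left; exists h|apply: alphaE].
  exists (comap r x); last exact: rE.
  have : range (comap r) (comap r x) by exists x.
  by rewrite ME; apply: alg_span_mono => c; right.
have [g' [eg' g'E]] : exists g' : pghom G' K, epi g' /\ hom_eq (comp_hom alpha g') f'.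
  apply: sat => //; try exact: covered_pro; last exact: Kle gen.
  exact: epi_factor alphaE ef.
exists K, g, g', alpha, M; split=> //; split=> // a /qL[x _ <-].
by exists (comap r x) => //; apply: rE.
Qed.

End Extension.

Section States.
Variables (k : fieldType) (C : progroup k -> Prop) (fC : formation C).
Variables (G G' : progroup k).
Hypothesis G_cov : covered C G.
Local Notation A := (coordring G).
Local Notation A' := (coordring G').
Local Notation AA := (A * A')%type.

Definition common_quotient (S : set AA) : Prop :=
  exists (H : progroup k) (f : pghom G H) (f' : pghom G' H),
    [/\ epi f, epi f', graph f f' = S & covered C H].

Lemma epi_covered H K (f : pghom H K) (F : seq (coordring H)) :
  covered C K -> epi f -> (forall a, a \in F -> range (comap f) a) ->
  exists (X : progroup k) (q : pghom H X),
    [/\ C X, epi q & forall a, a \in F -> range (comap q) a].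
Proof.
move=> Kcov ef Ff; have [|E [FE _]] := @seq_choice _ _ (fun a b => comap f b = a) F.
  by move=> a /Ff[b _ <-]; exists b.
have [X [q [CX eq qE]]] := Kcov E.
exists X, (comp_hom q f); split=> //; first exact: epi_comp.
by move=> a /FE[b /qE[x _ <-] <-]; exists x.
Qed.

(** The graph of the trivial common quotient. *)
Definition scalars : set AA := range (fun d : k => d *: (1 : AA)).

Lemma scalars_common_quotient : common_quotient scalars.
Proof.
have rel : hopf_relation scalars.
  split.
  - split=> [|c _ _ [u _ <-] [v _ <-]|_ _ [u _ <-] [v _ <-]].
    + by exists 1; rewrite ?scale1r.
    + by exists (c * u + v); rewrite ?scalerDl ?scalerA.
    + by exists (u * v); rewrite // -scalerAl mul1r scalerA.
  - split=> _ [d _ <-] /= /eqP; rewrite scaler_eq0 oner_eq0 orbF => /eqP ->;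
      exact: scale0r.
  - move=> _ [d _ <-]; exists d => //.
    by rewrite /= !linearZ /= !rmorph1.
  - move=> _ [d _ <-]; exists [:: (d *: 1, 1)]; split.
    + move=> q; rewrite inE => /eqP ->; split; first by exists d.
      by exists 1; rewrite ?scale1r.
    + move=> R x y; rewrite big_seq1 /= rmorph1 mulr1.
      by rewrite !linearZ /= !rmorph1.
    + move=> R x y; rewrite big_seq1 /= rmorph1 mulr1.
      by rewrite !linearZ /= !rmorph1.
have [H [f [f' [ef ef' fE]]]] := hopf_relation_graph rel.
exists H, f, f'; split=> // F.
have HC : C H.
  apply: (fg_quotient_in_class fC G_cov (s := [::]) ef) => _ [h _ <-].
  have : graph f f' (comap f h, comap f' h) by exists h.
  rewrite fE => -[d _ [<- _]]; have sp := subalgebra_span [set a : A | a \in [::]].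
  by have [sp1 _ _] := sp; exact: (subalgebra_Z d sp sp1).
by exists H, (id_hom H); split.
Qed.

Lemma scalars_sub (S : set AA) : subalgebra S -> scalars `<=` S.
Proof. by move=> sS _ [d _ <-]; have [S1 _ _] := sS; exact: (subalgebra_Z d sS S1). Qed.

Lemma graph_subalgebra H (f : pghom G H) (f' : pghom G' H) : subalgebra (graph f f').
Proof.
have [j jE] := graph_map f f'.
have -> : graph f f' = range j by congr image; apply/funext => h.
exact: subalgebra_range.
Qed.

Lemma common_quotient_subalgebra S : common_quotient S -> subalgebra S.
Proof. by move=> [H [f [f' [_ _ <- _]]]]; apply: graph_subalgebra. Qed.

Lemma chain_seq (T : eqType) (F : set (set T)) (s : seq T) : F !=set0 -> total_on F subset ->
  (forall a, a \in s -> exists2 S, F S & S a) ->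
  exists2 S, F S & forall a, a \in s -> S a.
Proof.
move=> [S0 FS0] tot; elim: s => [|a s IHs] h; first by exists S0.
have [|S FS Ss] := IHs; first by move=> b bs; apply: h; rewrite inE bs orbT.
have [S' FS' S'a] := h a (mem_head _ _).
have [SS'|S'S] := tot _ _ FS FS'.
  by exists S' => // b; rewrite inE => /orP[/eqP ->//|/Ss /SS'].
by exists S => // b; rewrite inE => /orP[/eqP ->|/Ss//]; apply: S'S.
Qed.

(** Every condition in [hopf_relation] involves finitely many elements, so it can be
    checked in a single member of the chain; the same holds for covering a finite
    list by a quotient in C. *)
Lemma bigcup_common_quotient (F : set (set AA)) : F !=set0 -> total_on F subset ->
  (forall S, F S -> common_quotient S) -> common_quotient (\bigcup_(S in F) S).
Proof.
move=> F0 tot Fq; set U := \bigcup_(S in F) S.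
have UE (s : seq AA) : (forall a, a \in s -> U a) -> exists2 S, F S & forall a, a \in s -> S a.
  by move=> sU; apply: chain_seq => // a /sU[S FS Sa]; exists S.
have Frel S : F S -> hopf_relation S.
  by move=> /Fq[H [f [f' [ef ef' <- _]]]]; apply: graph_hopf_relation.
have sub S : F S -> S `<=` U by move=> FS a Sa; exists S.
have rel : hopf_relation U.
  split.
  - split=> [|c u v Uu Uv|u v Uu Uv].
    + by have [S FS] := F0; exists S => //; have [[]] := Frel S FS.
    + have [|S FS SE] := UE [:: u; v]; first by move=> a; rewrite !inE => /orP[]/eqP ->.
      exists S => //; have [[_ Sl _] _ _ _] := Frel S FS.
      by apply: Sl; apply: SE; rewrite !inE eqxx ?orbT.
    + have [|S FS SE] := UE [:: u; v]; first by move=> a; rewrite !inE => /orP[]/eqP ->.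
      exists S => //; have [[_ _ SM] _ _ _] := Frel S FS.
      by apply: SM; apply: SE; rewrite !inE eqxx ?orbT.
  - by split=> p [S FS Sp]; have [_ [S1 S2] _ _] := Frel S FS; [apply: S1|apply: S2].
  - by move=> p [S FS Sp]; exists S => //; have [_ _ SV _] := Frel S FS; apply: SV.
  - move=> p [S FS Sp]; have [_ _ _ /(_ p Sp)[s [sS s1 s2]]] := Frel S FS.
    by exists s; split=> // q /sS[q1 q2]; split; exists S.
have [H [f [f' [ef ef' fE]]]] := hopf_relation_graph rel.
exists H, f, f'; split=> // E.
have [|S FS SE] := UE [seq (comap f h, comap f' h) | h <- E].
  by move=> _ /mapP[h _ ->]; rewrite -fE; exists h.
have [H1 [f1 [f1' [e1 e1' f1E cov1]]]] := Fq S FS.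
have [g gE] : exists g, hom_eq (comp_hom g f) f1.
  apply: hom_factor_range => // _ [h _ <-].
  have : U (comap f1 h, comap f1' h) by apply: (sub S) => //; rewrite -f1E; exists h.
  by rewrite -fE => -[h' _ [<- _]]; exists h'.
apply: (epi_covered cov1 (epi_factor gE e1)) => h hE.
have := SE _ (map_f (fun h => (comap f h, comap f' h)) hE).
by rewrite -f1E => -[h1 _ [E1 _]]; exists h1 => //; apply: ef; rewrite -E1; apply: gE.
Qed.

End States.

Section StateExtension.
Variables (k : fieldType) (C : progroup k -> Prop) (fC : formation C).
Variables (G G' : progroup k) (T : Type) (D : set T).
Hypotheses (G_sat : saturated C G) (G'_sat : saturated C G').
Local Notation A := (coordring G).
Local Notation A' := (coordring G').
Local Notation AA := (A * A')%type.
Hypothesis small : forall K, covered C K -> generated_by D (coordring K) ->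
  rank_lt K G /\ rank_lt K G'.

(** Both halves of a successor step, with the result described by generators of its
    graph, because the stages of the construction are subalgebras given by
    generators. *)
Lemma extend_common_quotient (gen : T -> seq AA) (L : seq A) (L' : seq A') :
  common_quotient C (alg_span [set p | exists2 d, D d & p \in gen d]) ->
  exists M : seq AA,
    let S := alg_span [set p | p \in M \/ exists2 d, D d & p \in gen d] in
    [/\ common_quotient C S, forall a, a \in L -> exists2 p, S p & p.1 = a
      & forall a, a \in L' -> exists2 p, S p & p.2 = a].
Proof.
set X := [set p | _]; move=> [H [f [f' [ef ef' fE Hcov]]]].
have Gcov : covered C G by apply: pro_covered; case: G_sat.
have G'cov : covered C G' by apply: pro_covered; case: G'_sat.
have Hgen : generated_by D (coordring H).
  have /choice[genH genHE] : forall d, exists s : seq (coordring H), D d ->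
      forall p, p \in gen d -> exists2 h, h \in s & (comap f h, comap f' h) = p.
    move=> d; have [Dd|nDd] := pselect (D d); last by exists [::].
    have [|s [sE _]] := @seq_choice AA (coordring H) (fun p h => (comap f h, comap f' h) = p) (gen d).
      move=> p pd; have : alg_span X p by apply: sub_alg_span; exists d.
      by rewrite -fE => -[h _ hE]; exists h.
    by exists s.
  exists genH, [::] => a; have [j jE] := graph_map f f'.
  have jinj : injective j by move=> u v; rewrite !jE => -[/ef].
  apply: (@alg_span_lift _ _ _ j X) => // [p [d Dd pd]|].
    have [h hs hE] := genHE d Dd p pd; exists h; last by rewrite jE.
    by apply: sub_alg_span; right; exists d.
  by rewrite -fE jE; exists a.
have [_ HltG'] := small Hcov Hgen.
have [|K [g [g' [alpha [M [[eg eg' Kcov] [alphaE alphaE' Mgen gL]]]]]]] :=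
    extend_left fC (f := f) (f' := f') L Gcov G'_sat Hcov ef ef' HltG'.
  move=> K alpha M Kcov Mgen.
  by have [_ []] := small Kcov (generated_by_extend Hgen Mgen).
have Kgen := generated_by_extend Hgen Mgen.
have [KltG _] := small Kcov Kgen.
(* The same step with the two groups exchanged. *)
have [|K2 [g2' [g2 [beta [M2 [[eg2' eg2 K2cov] [betaE' betaE M2gen gL']]]]]]] :=
    extend_left fC (f := g') (f' := g) L' G'cov G_sat Kcov eg' eg KltG.
  move=> K2 beta M2 K2cov M2gen.
  by have [[]] := small K2cov (generated_by_extend Kgen M2gen).
have [j jE] := graph_map g2 g2'.
exists (map j (map (comap beta) M ++ M2)) => /=; set S := alg_span _.
have jbeta h : j (comap beta (comap alpha h)) = (comap f h, comap f' h).
  rewrite jE; have /= -> := betaE (comap alpha h); have /= -> := betaE' (comap alpha h).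
  by rewrite -alphaE -alphaE'.
have SE : graph g2 g2' = S.
  apply/seteqP; split=> [_ [b _ <-]|]; last first.
    apply: alg_span_min; first exact: graph_subalgebra.
    move=> p [/mapP[b _ ->]|[d Dd pd]]; first by exists b; rewrite ?jE.
    have : alg_span X p by apply: sub_alg_span; exists d.
    by rewrite -fE => -[h _ <-]; rewrite -jbeta jE; exists (comap beta (comap alpha h)).
  rewrite -jE; apply: alg_span_map (M2gen b) => b' [[c _ <-]|cM]; last first.
    by apply: sub_alg_span; left; rewrite map_f // mem_cat [_ \in M2]cM orbT.
  apply: (alg_span_map (f := (j \o comap beta)) _ (Mgen c)) => b'' [[h _ <-]|hM].
    have : alg_span X (comap f h, comap f' h) by rewrite -fE; exists h.
    by rewrite /= jbeta; apply: alg_span_mono => p; right.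
  by apply: sub_alg_span; left; rewrite /= map_f // mem_cat map_f.
split; first by exists K2, g2, g2'.
  move=> a /gL[b _ <-]; rewrite -SE; exists (j (comap beta b)); rewrite jE //=.
    by exists (comap beta b).
  exact: betaE.
by move=> a /gL'[b _ <-]; rewrite -SE; exists (j b); rewrite jE //; exists b.
Qed.

End StateExtension.

(** * Infinite cardinals *)

Section Cardinals.
Variable T : pointedType.
Implicit Types X Y Z : set T.

Definition inj_on (V : Type) (D : set V) (f : V -> T) : Prop :=
  forall u v, D u -> D v -> f u = f v -> u = v.

Lemma card_leI (V : Type) (D : set V) X (f : V -> T) :
  (forall v, D v -> X (f v)) -> inj_on D f -> D #<= X.
Proof.
move=> fX fi; have E : f @` D #= D.
  by apply: inj_card_eq => u v /set_mem Du /set_mem Dv; apply: fi.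
have /card_eqPle[_ le] := E; apply: card_le_trans le _.
by apply: subset_card_le => _ [v Dv <-]; apply: fX.
Qed.

Lemma card_le_inj (V : pointedType) (D : set V) X : D #<= X ->
  exists f : V -> T, (forall v, D v -> X (f v)) /\ inj_on D f.
Proof.
move=> /pcard_leP[f]; exists f; split=> [v Dv|u v Du Dv E].
  exact: (@funS _ _ _ _ f).
by apply: (@inj _ _ _ f) => //; apply: mem_set.
Qed.

Lemma glue_functions (I V : Type) (F : set I) (dom : I -> set V) (f : I -> V -> T) :
  (forall i j v, F i -> F j -> dom i v -> dom j v -> f i v = f j v) ->
  exists g : V -> T, forall i v, F i -> dom i v -> g v = f i v.
Proof.
move=> E; have /choice[g gE] : forall v, exists t, forall i, F i -> dom i v -> t = f i v.
  move=> v; have [[i [Fi iv]]|no] := pselect (exists i, F i /\ dom i v).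
    by exists (f i v) => j Fj jv; apply: E.
  by exists point => i Fi iv; case: no; exists i.
by exists g => i v; apply: gE.
Qed.

(** A maximal injective partial map from X to Y is total or onto, for otherwise it
    could be extended by one more point. *)
Lemma card_le_total X Y : X #<= Y \/ Y #<= X.
Proof.
pose good (p : set T * (T -> T)) :=
  [/\ p.1 `<=` X, forall v, p.1 v -> Y (p.2 v) & inj_on p.1 p.2].
pose le (p q : {p | good p}) :=
  `[< (sval p).1 `<=` (sval q).1 /\ forall v, (sval p).1 v -> (sval p).2 v = (sval q).2 v >].
have good0 : good (set0, id) by split=> // u v [].
have [|||p pmax] := @ZL_preorder _ (exist _ _ good0) le.
- by move=> p; apply/asboolP; split.
- move=> p q r /asboolP[pq Epq] /asboolP[qr Eqr]; apply/asboolP.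
  by split=> [v /pq /qr //|v pv]; rewrite Epq // Eqr //; apply: pq.
- move=> F tot.
  have two p q : F p -> F q -> exists2 r, F r & le p r /\ le q r.
    have lexx r : le r r by apply/asboolP; split.
    by move=> Fp Fq; have [pq|qp] := tot p q Fp Fq; [exists q|exists p].
  have [|g gE] := @glue_functions _ T F (fun p => (sval p).1) (fun p => (sval p).2).
    move=> p q v Fp Fq pv qv; have [r Fr [/asboolP[_ E1] /asboolP[_ E2]]] := two _ _ Fp Fq.
    by rewrite E1 // E2.
  pose D := [set v | exists2 p, F p & (sval p).1 v].
  have gD : good (D, g).
    split=> [v [p Fp pv]|v [p Fp pv]|u v [p Fp pu] [q Fq qv]] /=.
    + by have [pX _ _] := svalP p; apply: pX.
    + by rewrite (gE p) //; have [_ pY _] := svalP p; apply: pY.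
    have [r Fr [/asboolP[pr _] /asboolP[qr _]]] := two _ _ Fp Fq.
    have [ru rv] := (pr u pu, qr v qv).
    by rewrite !(gE r) //; have [_ _ ri] := svalP r; apply: ri.
  exists (exist _ _ gD) => p Fp; apply/asboolP; split=> [v pv|v pv] /=; first by exists p.
  by rewrite (gE p).
case: p pmax => -[D f] /= gp pmax; have [/= DX fY fi] := gp.
have [[x [Xx Dx]]|tot] := pselect (exists x, X x /\ ~ D x); last first.
  left; apply: (card_leI (f := f)) => [v Xv|u v Xu Xv].
    by apply: fY; apply: contrapT => Dv; apply: tot; exists v.
  by apply: fi; apply: contrapT => Dv; apply: tot; [exists u|exists v].
have [[y [Yy fy]]|surj] := pselect (exists y, Y y /\ forall v, D v -> f v <> y); last first.
  have /choice[h hE] : forall y, exists v, Y y -> D v /\ f v = y.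
    move=> y; have [Yy|] := pselect (Y y); last by exists point.
    apply: contrapT => no; apply: surj; exists y; split=> // v Dv fv.
    by apply: no; exists v.
  right; apply: (card_leI (f := h)) => [y /hE[/DX]//|u v /hE[_ {2}<-] /hE[_ {2}<-] ->//].
pose f' v := if pselect (v = x) then y else f v.
have f'x : f' x = y by rewrite /f'; case: pselect.
have f'D v : D v -> f' v = f v by move=> Dv; rewrite /f'; case: pselect => // E; case: Dx; rewrite -E.
have gp' : good ((fun v => D v \/ v = x), f').
  split=> [v [/DX//|-> //]|v [Dv|->]|u v [Du|->] [Dv|->]] //=.
  - by rewrite f'D //; apply: fY.
  - by rewrite f'x.
  - by rewrite !f'D //; apply: fi.
  - by rewrite f'x f'D // => E; case: (fy _ Du).
  - by rewrite f'x f'D // => E; case: (fy _ Dv).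
have /pmax /asboolP[/(_ x) /= sub _] : le (exist _ _ gp) (exist _ _ gp').
  by apply/asboolP; split=> [v Dv|v Dv /=]; [left|rewrite f'D].
by case: Dx; apply: sub; right.
Qed.

Definition lists X : set (seq T) := [set l | forall a, a \in l -> X a].

(** Take a maximal pair of a set Y in X and an injection g of the lists over Y into Y;
    a countable Y provides a first one.  Lists over Y encode lists over two copies of
    Y by prefixing each letter with one of two marks c0, c1.  If the complement of Y
    is not larger than Y, lists over X are encoded by lists over Y in this way.
    Otherwise the complement contains a copy h(Y) of Y, and the lists over the union
    of Y and h(Y) that are not lists over Y can be sent to h(Y), contradicting
    maximality. *)
Lemma card_lists X : infinite_set X -> lists X #<= X.
Proof.
move=> Xinf.
pose good (p : set T * (seq T -> T)) :=
  [/\ p.1 `<=` X, forall l, lists p.1 l -> p.1 (p.2 l) & inj_on (lists p.1) p.2].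
pose le (p q : {p | good p}) := `[< (sval p).1 `<=` (sval q).1 /\
  forall l, lists (sval p).1 l -> (sval p).2 l = (sval q).2 l >].
have [p0 good0] : exists p, good p.
  have /card_le_inj[e [eX ei]] : [set: nat] #<= X by apply/infiniteP.
  have /choice[d dE] : forall t, exists n, range e t -> e n = t.
    move=> t; have [[n _ <-]|] := pselect (range e t); first by exists n.
    by exists 0%N.
  exists (range e, fun l => e (pickle (map d l))); split=> [_ [n _ <-]|l _|l l' hl hl' /=].
  - exact: eX.
  - by exists (pickle (map d l)).
  move=> /(ei _ _ I I) /(pcan_inj pickleK) E.
  have dK s : lists (range e) s -> map e (map d s) = s.
    by move=> hs; rewrite -map_comp; apply: map_id_in => t /hs /dE.
  by rewrite -(dK l) // E dK.
have [|||p pmax] := @ZL_preorder _ (exist _ _ good0) le.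
- by move=> p; apply/asboolP; split.
- move=> p q r /asboolP[pq Epq] /asboolP[qr Eqr]; apply/asboolP.
  split=> [v /pq /qr //|l pl]; rewrite Epq // Eqr // => a /pl; exact: pq.
- move=> F tot; have [[q0 Fq0]|no] := pselect (exists q, F q); last first.
    by exists (exist _ _ good0) => q Fq; case: no; exists q.
  have lexx r : le r r by apply/asboolP; split.
  have two p q : F p -> F q -> exists2 r, F r & le p r /\ le q r.
    by move=> Fp Fq; have [pq|qp] := tot p q Fp Fq; [exists q|exists p].
  have le_lists p q l : le p q -> lists (sval p).1 l -> lists (sval q).1 l.
    by move=> /asboolP[pq _] pl a /pl /pq.
  have [|g gE] := @glue_functions _ (seq T) F (fun p => lists (sval p).1) (fun p => (sval p).2).
    move=> p q v Fp Fq pv qv; have [r Fr [/asboolP[_ E1] /asboolP[_ E2]]] := two _ _ Fp Fq.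
    by rewrite E1 // E2.
  pose D := [set v | exists2 p, F p & (sval p).1 v].
  have Dl l : lists D l -> exists2 p, F p & lists (sval p).1 l.
    elim: l => [|a l IHl] h; first by exists q0.
    have [|p Fp pl] := IHl; first by move=> b bl; apply: h; rewrite inE bl orbT.
    have [q Fq qa] := h a (mem_head _ _); have [r Fr [pr qr]] := two _ _ Fp Fq.
    exists r => // b; rewrite inE => /orP[/eqP ->|bl].
      by move/asboolP: qr => [qr _]; apply: qr.
    exact: (le_lists _ _ _ pr pl).
  have gD : good (D, g).
    split=> [v [p Fp pv]|l /Dl[p Fp pl]|l l' /Dl[p Fp pl] /Dl[q Fq ql]] /=.
    + by have [pX _ _] := svalP p; apply: pX.
    + by exists p => //; rewrite (gE p) //; have [_ pY _] := svalP p; apply: pY.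
    have [r Fr [pr qr]] := two _ _ Fp Fq.
    have [ru rv] := (le_lists _ _ _ pr pl, le_lists _ _ _ qr ql).
    by rewrite !(gE r) //; have [_ _ ri] := svalP r; apply: ri.
  exists (exist _ _ gD) => p Fp; apply/asboolP; split=> [v pv|v pv] /=; first by exists p.
  by rewrite (gE p).
case: p pmax => -[Y g] /= gp pmax; have [/= YX gY gi] := gp.
have Y0 : lists Y [::] by [].
(* two distinct elements of Y, to be used as marks *)
pose c0 := g [::]; have Yc0 : Y c0 by apply: gY.
have Yl1 a : Y a -> lists Y [:: a] by move=> Ya b; rewrite inE => /eqP ->.
pose c1 := g [:: c0]; have Yc1 : Y c1 by apply/gY/Yl1.
have c01 : c0 <> c1 by move=> /(gi _ _ Y0 (Yl1 _ Yc0)).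
pose code (h : T -> T) x := if pselect (Y x) then [:: c0; x] else [:: c1; h x].
have codeY h x : (~ Y x -> Y (h x)) -> lists Y (code h x).
  rewrite /code; case: pselect => [Yx _|nYx hx] a; rewrite !inE => /orP[]/eqP -> //.
  exact: hx.
have code_size h x : size (code h x) = 2 by rewrite /code; case: pselect.
have code_inj (Z : set T) h : (forall u v, Z u -> Z v -> ~ Y u -> ~ Y v -> h u = h v -> u = v) ->
    forall u v, Z u -> Z v -> code h u = code h v -> u = v.
  move=> hi u v Zu Zv; rewrite /code; case: pselect => Yu; case: pselect => Yv [].
  - by [].
  - by move=> /c01.
  - by move=> /esym /c01.
  - exact: hi.
have flat_inj (Z : set T) (c : T -> seq T) : (forall x, size (c x) = 2) ->
    (forall u v, Z u -> Z v -> c u = c v -> u = v) ->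
    forall l l', lists Z l -> lists Z l' ->
      flatten (map c l) = flatten (map c l') -> l = l'.
  move=> c2 ci; elim=> [|a l IHl] [|b l'] //= hl hl'.
  - by move=> /(congr1 size); rewrite size_cat c2.
  - by move=> /(congr1 size); rewrite size_cat c2.
  move=> /eqP; rewrite eqseq_cat ?c2 // => /andP[/eqP ab /eqP ll'].
  have tail (s : seq T) t : lists Z (t :: s) -> lists Z s.
    by move=> h x xs; apply: h; rewrite inE xs orbT.
  rewrite (IHl l') //; [|exact: tail hl|exact: tail hl'].
  by rewrite (ci a b) //; [apply: hl|apply: hl']; apply: mem_head.
have flatY (Z : set T) c : (forall x, Z x -> lists Y (c x)) ->
    forall l, lists Z l -> lists Y (flatten (map c l)).
  move=> cY l hl a /flattenP[s /mapP[x xl ->]]; apply: cY.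
  exact: hl.
have [le1|le1] := card_le_total (X `\` Y) Y.
  have [h [hY hi]] := card_le_inj le1.
  pose f l := g (flatten (map (code h) l)).
  have cX x : X x -> lists Y (code h x).
    by move=> Xx; apply: codeY => nYx; apply: hY.
  apply: (card_leI (f := f)) => [l hl|l l' hl hl' E].
    exact: (YX _ (gY _ (flatY X _ cX _ hl))).
  apply: (flat_inj X (code h) (code_size h) _ _ _ hl hl').
    by apply: (code_inj X h) => u v Xu Xv nu nv; exact: (hi u v (conj Xu nu) (conj Xv nv)).
  exact: (gi _ _ (flatY X _ cX _ hl) (flatY X _ cX _ hl') E).
have [h [hX hi]] := card_le_inj le1; exfalso.
pose Z x := Y x \/ (h @` Y) x.
have /choice[h' h'E] : forall z, exists y, (h @` Y) z -> Y y /\ h y = z.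
  move=> z; have [[y Yy <-]|] := pselect ((h @` Y) z); first by exists y.
  by exists point.
have cZ x : Z x -> lists Y (code h' x).
  by move=> Zx; apply: codeY => nYx; case: Zx => // /h'E[].
have cZi u v : Z u -> Z v -> code h' u = code h' v -> u = v.
  apply: (code_inj Z h') => {}u {}v [//|/h'E[_ Eu]] [//|/h'E[_ Ev]] _ _ E.
  by rewrite -Eu E.
pose g' l := if pselect (lists Y l) then g l else h (g (flatten (map (code h') l))).
have g'Y l : lists Y l -> g' l = g l by rewrite /g'; case: pselect.
have g'Z l : ~ lists Y l -> g' l = h (g (flatten (map (code h') l))).
  by rewrite /g'; case: pselect.
have gfl l : lists Z l -> Y (g (flatten (map (code h') l))) by move=> hl; apply: gY; exact: (flatY Z _ cZ).
have hN y : Y y -> ~ Y (h y) by move=> /hX[].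
have gp' : good (Z, g').
  split=> [x [/YX//|[y /hX[? _] <-//]]|l hl|l l' hl hl'] /=.
  - have [lY|lY] := pselect (lists Y l); first by rewrite g'Y //; left; apply: gY.
    by rewrite g'Z //; right; exists (g (flatten (map (code h') l))) => //; apply: gfl.
  have [lY|lY] := pselect (lists Y l); have [lY'|lY'] := pselect (lists Y l').
  - by rewrite !g'Y //; apply: gi.
  - by rewrite g'Y // g'Z // => E; case: (hN _ (gfl _ hl')); rewrite -E; apply: gY.
  - by rewrite g'Z // g'Y // => E; case: (hN _ (gfl _ hl)); rewrite E; apply: gY.
  rewrite !g'Z // => E; apply: (flat_inj Z (code h')) => //.
  apply: (gi _ _ (flatY Z _ cZ _ hl) (flatY Z _ cZ _ hl')).
  by apply: hi E; apply: gfl.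
have /pmax /asboolP[/(_ (h c0)) /= sub _] : le (exist _ _ gp) (exist _ _ gp').
  by apply/asboolP; split=> [v Yv|l Yl /=]; [left|rewrite g'Y].
by apply: (hN c0 Yc0); apply: sub; right; exists c0.
Qed.

(** Cut a well-order of X before the first element that already has X-many
    predecessors, if there is one. *)
Lemma initial_well_order X : exists (D : set T) (lt : T -> T -> Prop),
  [/\ well_founded lt, forall u v, lt u v \/ u = v \/ lt v u,
      forall u v w, lt u v -> lt v w -> lt u w, D #= X
    & forall i, D i -> ~ (X #<= [set j | D j /\ lt j i])].
Proof.
have [R Rwo] := wochoice.well_ordering_principle T.
pose lt u v := R u v /\ u <> v.
have Rmin (P : set T) : P !=set0 -> exists z, P z /\ forall v, P v -> R z v.
  move=> [x Px]; have [|z [[Pz zmin] _]] := Rwo [pred v | `[< P v >]].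
    by exists x; apply: (introT (asboolP (P x))).
  exists z; split; first exact: (elimT (asboolP (P z)) Pz).
  by move=> v Pv; apply: zmin; apply: (introT (asboolP (P v))).
have Rtot u v : R u v \/ R v u.
  have [|z [[->|->] zmin]] := Rmin [set w | w = u \/ w = v]; first by exists u; left.
    by left; apply: zmin; right.
  by right; apply: zmin; left.
have Ranti u v : R u v -> R v u -> u = v.
  move=> uv vu; have [|z [_ zu]] := Rwo [pred w | (w == u) || (w == v)].
    by exists u; rewrite inE eqxx.
  have Rxx w : R w w by case: (Rtot w w).
  suff E w : w = u \/ w = v -> z = w by rewrite -(E u) ?(E v); [|right|left].
  move=> wuv; apply: zu; split=> [|x]; rewrite inE.
    by case: wuv => ->; rewrite eqxx ?orbT.
  by case: wuv => -> /orP[]/eqP ->.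
have Rtrans u v w : R u v -> R v w -> R u w.
  move=> uv vw; have [|z [zP zmin]] := Rmin [set x | [\/ x = u, x = v | x = w]].
    by exists u; constructor 1.
  have [zu [zv zw]] : R z u /\ R z v /\ R z w.
    by split; [|split]; apply: zmin; [constructor 1|constructor 2|constructor 3].
  case: zP => E; rewrite E in zu zv zw => //.
    by rewrite (Ranti u v).
  by rewrite -(Ranti v w).
have lt_tri u v : lt u v \/ u = v \/ lt v u.
  have [->|uv] := pselect (u = v); first by right; left.
  have [h|h] := Rtot u v; first by left.
  by right; right; split=> // /esym.
have lt_wf : well_founded lt.
  move=> x; apply: contrapT => nx.
  have [|z [nz zmin]] := Rmin [set v | ~ Acc lt v]; first by exists x.
  apply: nz; constructor => v [vz nvz]; apply: contrapT => nv.
  by apply: nvz; apply: Ranti => //; apply: zmin.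
have lt_trans u v w : lt u v -> lt v w -> lt u w.
  move=> [uv nuv] [vw nvw]; split; first exact: Rtrans vw.
  by move=> uw; apply: nuv; apply: Ranti => //; rewrite uw.
have [big|small] := pselect (exists i, X i /\ X #<= [set j | X j /\ lt j i]); last first.
  by exists X, lt; split=> // i Xi le; apply: small; exists i.
have [i0 [[Xi0 le0] imin]] := Rmin _ big.
exists [set j | X j /\ lt j i0], lt; split=> //.
  by apply: Cantor_Bernstein => //; apply: subset_card_le => j [].
move=> i [Xi [Ri ni]] le; apply: ni; apply: Ranti => //; apply: imin; split=> //.
by apply: card_le_trans le _; apply: subset_card_le => j [[]].
Qed.

End Cardinals.

(** * Rank *)

Section Rank.
Variables (k : fieldType) (G : progroup k).
Local Notation A := (coordring G).
Implicit Types R : comAlgType k.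

(** The largest ideal that vanishes on all points of the kernel of q.  Defining it by
    points makes membership in the kernel subgroup scheme immediate. *)
Definition kernel_ideal X (q : pghom G X) : set A :=
  [set a | forall R (x : pt G R), map_pt q x = pone X R -> x a = 0].

Lemma in_kernelP X (q : pghom G X) R (x : pt G R) :
  in_closed (kernel_ideal q) x <-> map_pt q x = pone X R.
Proof.
split=> [h|E a]; last by apply.
apply: lrmorph_ext => b; rewrite poneE; apply/eqP; rewrite -subr_eq0.
have -> : map_pt q x b - (counit X b)%:A = x (comap q b - (counit X b)%:A).
  by rewrite [RHS]linearB [in RHS]linearZ /= rmorph1.
apply/eqP/h => S y /(congr1 (fun z : pt X S => z b)).
by rewrite poneE linearB linearZ /= rmorph1 => ->; rewrite subrr.
Qed.

Lemma kernel_coalgebraic X (q : pghom G X) :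
  epi q -> algebraic X -> coalgebraic G (kernel_ideal q).
Proof.
move=> eq algX; have pinv1 R : pinv (pone X R) = pone X R.
  by apply/esym/pmul_eq1; rewrite pmul1g.
split; last by exists X, q; split=> //; split=> // R x; apply: in_kernelP.
split; last first.
  move=> R x y /in_kernelP E; apply/in_kernelP.
  by rewrite !map_ptM E pmulg1 map_ptV pmulgV.
split.
  split=> [R x _|a b ha hb R x E|a b hb R x E].
  - by rewrite linear0.
  - by rewrite linearD /= ha // hb // addr0.
  - by rewrite rmorphM /= (hb R x E) mulr0.
move=> R; split.
- by apply/in_kernelP; apply: map_pt1.
- by move=> x y /in_kernelP Ex /in_kernelP Ey; apply/in_kernelP; rewrite map_ptM Ex Ey pmul1g.
- by move=> x /in_kernelP Ex; apply/in_kernelP; rewrite map_ptV Ex.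
Qed.

Lemma quotient_ideal_sub X Q (q : pghom G X) (f : pghom G Q) (I : set A) : epi q ->
  is_quotient I f -> range (comap f) `<=` range (comap q) -> I `<=` kernel_ideal q.
Proof.
move=> eq [ef fI] sub a Ia R x Ex; have [w wE] := hom_factor_range eq sub.
suff /fI : map_pt f x = pone Q R by apply.
have -> : map_pt f x = map_pt w (map_pt q x).
  by apply: lrmorph_ext => b /=; rewrite -wE.
by rewrite Ex map_pt1.
Qed.

Lemma rank_le_basis (B : set (set A)) : nbhd_basis G B -> rank G #<= B.
Proof.
move=> hB; rewrite /rank; case: asboolP => _; first exact: card_ge0.
by case: xgetP => [y _ [_ ->]//|_]; apply: card_ge0.
Qed.

Lemma rank_basis : infinite_set (rank G) -> nbhd_basis G (rank G).
Proof.
rewrite /rank; case: asboolP => _; first by case.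
by case: xgetP => [y _ []//|_ []].
Qed.

Lemma quotient_generators (I : set A) : coalgebraic G I ->
  exists (s : seq A) (Q : progroup k) (f : pghom G Q),
    is_quotient I f /\ range (comap f) = alg_span [set a | a \in s].
Proof.
move=> [_ [Q [f [fI [s gen]]]]]; by exists (map (comap f) s), Q, f; split=> //; apply: range_alg_span.
Qed.

Variables (C : progroup k -> Prop) (fC : formation C).
Hypothesis G_cov : covered C G.

(** For a list l in D, let X_l be a quotient in C whose ring contains the generators
    attached to l.  Any finitely many functions are generated by the lists over
    some l, so the kernels of the maps to the X_l form a neighbourhood basis.  There are
    at most |D| lists if D is infinite; if D is finite, a single l suffices. *)
Lemma rank_bound (T U : pointedType) (D : set T) (P : set U) :
  generated_by D A -> infinite_set P -> D #<= P -> ~ (P #<= D) ->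
  rank G #<= P /\ ~ (P #<= rank G).
Proof.
move=> [gen [L gA]] Pinf DP PD.
have Xq (l : seq T) := G_cov (L ++ flatten (map gen l)).
pose X l := projT1 (cid (Xq l)).
pose q l : pghom G (X l) := projT1 (cid (projT2 (cid (Xq l)))).
have qP l : [/\ C (X l), epi (q l)
    & forall a, a \in L ++ flatten (map gen l) -> range (comap (q l)) a].
  exact: (projT2 (cid (projT2 (cid (Xq l))))).
pose J l := kernel_ideal (q l).
have basis (W : set (seq T)) : (forall F : seq A, exists2 l, W l &
      forall a, a \in F -> range (comap (q l)) a) -> nbhd_basis G (J @` W).
  move=> cov; split=> [_ [l _ <-]|I /quotient_generators[s [Q [f [fI fs]]]]].
    have [CX eq _] := qP l.
    exact: (kernel_coalgebraic eq (formation_algebraic fC CX)).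
  have [l Wl lP] := cov s; exists (J l); first by exists l.
  have [_ eq _] := qP l; apply: quotient_ideal_sub eq fI _.
  by rewrite fs; apply: alg_span_min; [apply: subalgebra_range|].
have [Dfin|Dinf] := pselect (finite_set D).
  have [s sD] := (finite_seqP D).1 Dfin.
  have hB : nbhd_basis G (J @` [set s]).
    apply: basis => F; exists s => // a _; have [_ _ qs] := qP s.
    apply: (gA a); first exact: subalgebra_range.
    move=> b bL; apply: qs; rewrite mem_cat; case: bL => [->//|[d Dd bd]].
    apply/orP; right; apply/flattenP; exists (gen d) => //; apply: map_f.
    by rewrite sD in Dd.
  have fin : finite_set (J @` [set s]) by apply: finite_image; apply: finite_set1.
  have le := rank_le_basis hB; split.
    apply: card_le_trans le _.
    by apply: (card_le_trans (finite_set_countable fin)); apply/infiniteP.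
  by move=> le2; apply: Pinf; apply: card_le_finite (card_le_trans le2 le) fin.
have hB : nbhd_basis G (J @` lists D).
  apply: basis => F.
  have [|s [sX sF]] := @alg_span_finite k A [set b | exists2 d, D d & b \in gen d]
      [set b | b \in L] F.
    by move=> a _; apply: alg_span_mono (gA a) => b [|]; [right|left].
  have [|l [lP lD]] := @seq_choice A T (fun b d => D d /\ b \in gen d) s.
    by move=> b /sX[d Dd bd]; exists d.
  exists l => [d /lD[b _ []//]|a aF]; have [_ _ ql] := qP l.
  apply: (sF a aF); first exact: subalgebra_range.
  move=> b [/= bs|bL]; apply: ql; rewrite mem_cat; last by rewrite [b \in L]bL.
  have [d dl [_ bd]] := lP b bs; apply/orP; right; apply/flattenP.
  by exists (gen d) => //; apply: map_f.
have le : rank G #<= D.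
  apply: (card_le_trans (rank_le_basis hB)); apply: (card_le_trans (card_image_le _ _)).
  exact: card_lists.
split; first exact: card_le_trans le DP.
by move=> le2; apply: PD; apply: card_le_trans le2 le.
Qed.

(** A point in the kernel of f lies in every member N of the basis, since k[G/N] is
    contained in k[H].  Hence it lies in the kernel of every quotient of G in C, and
    these quotients cover k[G]. *)
Lemma basis_surjective H (f : pghom G H) : epi f -> infinite_set (rank G) ->
  (forall N, rank G N -> exists (Q : progroup k) (g : pghom G Q),
     is_quotient N g /\ range (comap g) `<=` range (comap f)) ->
  forall a, exists b, comap f b = a.
Proof.
move=> ef Ginf gen; have [_ basis] := rank_basis Ginf.
apply: trivial_kernel_surjective => // R x Ex; apply: lrmorph_ext => a.
have [X [q [CX eq qa]]] := G_cov [:: a].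
have [b _ ba] := qa a (mem_head _ _).
have [N PN sub] := basis _ (kernel_coalgebraic eq (formation_algebraic fC CX)).
have [Q [g [gN gf]]] := gen N PN.
have [w wE] := hom_factor_range ef gf.
have xN : in_closed N x.
  have [_ gP] := gN; apply/gP.
  have -> : map_pt g x = map_pt w (map_pt f x).
    by apply: lrmorph_ext => c /=; rewrite -wE.
  by rewrite Ex map_pt1.
have /in_kernelP E : in_closed (kernel_ideal q) x by move=> c /sub /xN.
rewrite -ba; have /(congr1 (fun z : pt X R => z b)) /= := E.
by rewrite -(map_pt1 q R).
Qed.

End Rank.

(** * Back and forth *)

Lemma bijective_isomorphic (k : fieldType) (G G' H : progroup k)
    (f : pghom G H) (f' : pghom G' H) : epi f -> epi f' ->
  (forall a, exists b, comap f b = a) -> (forall a, exists b, comap f' b = a) ->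
  isomorphic G G'.
Proof.
move=> ef ef' sf sf'.
have [g gE] : exists g, hom_eq (comp_hom g f) (id_hom G).
  by apply: hom_factor => // a; apply: sf.
have [g' g'E] : exists g', hom_eq (comp_hom g' f') (id_hom G').
  by apply: hom_factor => // a; apply: sf'.
exists (comp_hom g' f), (comp_hom g f'); split=> a /=.
  have -> : comap g' (comap f' (comap g a)) = comap g a.
    by apply: ef'; apply: g'E.
  exact: gE.
have -> : comap g (comap f (comap g' a)) = comap g' a by apply: ef; apply: gE.
exact: g'E.
Qed.

(** A valid choice at i may exist only because the earlier choices were valid, so the
    existence of a choice is a premise of the conclusion at i, to be proved afterwards
    by induction. *)
Lemma wf_choice (T V : Type) (lt : T -> T -> Prop) (v0 : V)
    (R : T -> (T -> V) -> V -> Prop) : well_founded lt ->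
  (forall i g g' v, (forall j, lt j i -> g j = g' j) -> R i g v -> R i g' v) ->
  exists g : T -> V, forall i, (exists v, R i g v) -> R i g (g i).
Proof.
move=> wf ext.
pose restr i (rec : forall j, lt j i -> V) (j : T) :=
  if pselect (lt j i) is left h then rec j h else v0.
pose F i (rec : forall j, lt j i -> V) : V :=
  if pselect (exists v, R i (restr i rec) v) is left h then projT1 (cid h) else v0.
pose g := Fix wf (fun=> V) F.
have gE i : g i = F i (fun j _ => g j).
  apply: Fix_eq => {}i r r' rr'; congr (F i _).
  by apply: functional_extensionality_dep => j; apply/funext => h; apply: rr'.
have restrE i j : lt j i -> restr i (fun j _ => g j) j = g j.
  by rewrite /restr; case: pselect.
exists g => i [v Rv]; rewrite gE /F; case: pselect => [h|no].
  by case: cid => w /= Rw; apply: ext Rw => j /restrE.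
by case: no; exists v; apply: ext Rv => j /restrE ->.
Qed.

Section BackAndForth.
Variables (k : fieldType) (C : progroup k -> Prop) (fC : formation C).
Variables (G G' : progroup k).
Hypotheses (G_sat : saturated C G) (G'_sat : saturated C G').
Local Notation A := (coordring G).
Local Notation A' := (coordring G').
Local Notation AA := (A * A')%type.
Variables (T : pointedType) (D : set T) (lt : T -> T -> Prop).
Hypothesis lt_wf : well_founded lt.
Hypothesis lt_tri : forall i j, lt i j \/ i = j \/ lt j i.
Hypothesis lt_trans : forall i j l, lt i j -> lt j l -> lt i l.
Hypothesis small : forall i, D i -> forall K, covered C K ->
  generated_by [set j | D j /\ lt j i] (coordring K) -> rank_lt K G /\ rank_lt K G'.
Variables (F : T -> seq A) (F' : T -> seq A').

Let G_cov : covered C G. Proof. by apply: pro_covered; case: G_sat. Qed.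
Let G'_cov : covered C G'. Proof. by apply: pro_covered; case: G'_sat. Qed.

(** The list M is a candidate for gen i, once the earlier values of gen are fixed. *)
Definition stage (gen : T -> seq AA) (i : T) (M : seq AA) : set AA :=
  alg_span [set p | p \in M \/ exists2 j, D j /\ lt j i & p \in gen j].

Definition good_stage i gen M :=
  [/\ common_quotient C (stage gen i M),
      forall a, a \in F i -> exists2 p, stage gen i M p & p.1 = a
    & forall a, a \in F' i -> exists2 p, stage gen i M p & p.2 = a].

(** The generated graph is the union of the chain of earlier stages.  The trivial
    quotient is added to the chain so that it is not empty at the first step. *)
Lemma limit_stage gen (W : set T) :
  (forall i j, W i -> D j -> lt j i -> W j) -> W `<=` D ->
  (forall i, W i -> common_quotient C (stage gen i (gen i))) ->
  common_quotient C (alg_span [set p | exists2 j, W j & p \in gen j]).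
Proof.
move=> Wdown WD Wq.
pose E := [set S | S = @scalars k G G' \/ exists2 i, W i & S = stage gen i (gen i)].
have Eq S : E S -> common_quotient C S.
  by case=> [->|[i Wi ->]]; [apply: scalars_common_quotient|apply: Wq].
have lt_stage i j : W i -> lt i j -> stage gen i (gen i) `<=` stage gen j (gen j).
  move=> Wi ij; apply: alg_span_mono => p [pi|[l [Dl li] pl]]; right.
    by exists i => //; split=> //; apply: WD.
  by exists l => //; split=> //; apply: lt_trans ij.
have Etot : total_on E subset.
  move=> S S' ES ES'; have sS := common_quotient_subalgebra (Eq _ ES).
  have sS' := common_quotient_subalgebra (Eq _ ES').
  case: ES sS => [-> _|[i Wi ->] sS]; first by left; apply: scalars_sub.
  case: ES' sS' => [-> _|[j Wj ->] _]; first by right; apply: scalars_sub.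
  have [ij|[->|ji]] := lt_tri i j; first by left; apply: lt_stage.
    by left.
  by right; apply: lt_stage.
have E0 : E !=set0 by exists (@scalars k G G'); left.
have Uq := bigcup_common_quotient E0 Etot Eq.
suff -> : alg_span [set p | exists2 j, W j & p \in gen j] = \bigcup_(S in E) S by [].
apply/seteqP; split.
  apply: alg_span_min; first exact: common_quotient_subalgebra Uq.
  move=> p [j Wj pj]; exists (stage gen j (gen j)); first by right; exists j.
  by apply: sub_alg_span; left.
move=> p [S [->|[i Wi ->]]]; first by apply: scalars_sub; apply: subalgebra_span.
apply: alg_span_mono => {}p [pi|[j [Dj ji] pj]]; first by exists i.
by exists j => //; apply: Wdown ji.
Qed.

Lemma back_and_forth : exists (H : progroup k) (f : pghom G H) (f' : pghom G' H),
  [/\ epi f, epi f',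
      forall i a, D i -> a \in F i -> range (comap f) a
    & forall i a, D i -> a \in F' i -> range (comap f') a].
Proof.
have [i gen gen' M E [q1 q2 q3]|gen genP] := @wf_choice T (seq AA) lt [::] good_stage lt_wf.
  suff -> : good_stage i gen' M = good_stage i gen M by split.
  suff S : stage gen' i M = stage gen i M by rewrite /good_stage S.
  congr alg_span; apply/funext => p; apply/propext.
  by split=> -[?|[j [Dj ji] pj]]; [left|right; exists j; rewrite ?E|left|right; exists j; rewrite -?E].
have good i : D i -> good_stage i gen (gen i).
  elim/(well_founded_ind lt_wf): i => i IH Di; apply: genP.
  apply: (extend_common_quotient fC G_sat G'_sat (small Di)).
  apply: limit_stage => [j l [Dj ji] Dl lj|j []//|j [Dj ji]].
    by split=> //; apply: lt_trans ji.
  by have [] := IH j ji Dj.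
have [H [f [f' [ef ef' fE _]]]] : common_quotient C (alg_span [set p | exists2 j, D j & p \in gen j]).
  by apply: limit_stage => // i /good[].
have sub i : D i -> stage gen i (gen i) `<=` graph f f'.
  move=> Di; rewrite fE; apply: alg_span_mono => p [pi|[j [Dj _] pj]]; first by exists i.
  by exists j.
exists H, f, f'; split=> // i a Di aF; have [_ h1 h2] := good i Di.
  by have [p /(sub i Di)[h _ <-] <-] := h1 a aF; exists h.
by have [p /(sub i Di)[h _ <-] <-] := h2 a aF; exists h.
Qed.

End BackAndForth.

Theorem theorem3p38 (k : fieldType) (C : progroup k -> Prop)
    (Gamma Gamma' : progroup k) :
  formation C -> saturated C Gamma -> saturated C Gamma' ->
  rank_eq Gamma Gamma' -> isomorphic Gamma Gamma'.
Proof.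
move=> fC sat sat' req.
have cov : covered C Gamma by apply: pro_covered; case: sat.
have cov' : covered C Gamma' by apply: pro_covered; case: sat'.
have inf : infinite_set (rank Gamma) by case: sat.
have inf' : infinite_set (rank Gamma') by case: sat'.
have /card_eqPle[le le'] : rank Gamma #= rank Gamma' := req.
have [D [lt [wf tri trans /card_eqPle[DP PD] Dsmall]]] := initial_well_order (rank Gamma).
have small i : D i -> forall K, covered C K ->
    generated_by [set j | D j /\ lt j i] (coordring K) -> rank_lt K Gamma /\ rank_lt K Gamma'.
  move=> Di K Kcov Kgen.
  have [|Kle Klt] := rank_bound fC Kcov Kgen inf _ (Dsmall i Di).
    by apply: card_le_trans DP; apply: subset_card_le => j [].
  split; split=> //; first by move=> /card_eqPle[_ /Klt].
    exact: card_le_trans Kle le.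
  by move=> /card_eqPle[_ /(card_le_trans le) /Klt].
have index (G : progroup k) : infinite_set (rank G) -> rank G #<= D ->
    exists F : set (coordring Gamma) -> seq (coordring G), forall N, rank G N ->
      exists i (Q : progroup k) (g : pghom G Q),
        [/\ D i, is_quotient N g & range (comap g) = alg_span [set a | a \in F i]].
  move=> Ginf /card_le_inj[e [eD ei]]; have [Gco _] := rank_basis Ginf.
  have /choice[s sP] : forall N, exists s : seq (coordring G), rank G N ->
      exists (Q : progroup k) (g : pghom G Q),
        is_quotient N g /\ range (comap g) = alg_span [set a | a \in s].
    move=> N; have [/Gco /quotient_generators[s [Q [g gP]]]|] := pselect (rank G N).
      by exists s => _; exists Q, g.
    by exists [::].
  have /choice[F FE] : forall i, exists t, forall N, rank G N -> e N = i -> t = s N.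
    move=> i; have [[N [PN <-]]|no] := pselect (exists N, rank G N /\ e N = i).
      by exists (s N) => N' PN' /ei ->.
    by exists [::] => N PN eN; case: no; exists N.
  exists F => N PN; have [Q [g [gN gs]]] := sP N PN.
  by exists (e N), Q, g; rewrite (FE _ N) //; split=> //; apply: eD.
have [F FP] := index Gamma inf PD.
have [F' F'P] := index Gamma' inf' (card_le_trans le' PD).
have [H [f [f' [ef ef' fF f'F']]]] := back_and_forth fC sat sat' wf tri trans small F F'.
apply: (bijective_isomorphic ef ef').
  apply: (basis_surjective fC cov ef inf) => N /FP[i [Q [g [Di gN gF]]]].
  exists Q, g; split=> //; rewrite gF; apply: alg_span_min; first exact: subalgebra_range.
  by move=> a; apply: fF.
apply: (basis_surjective fC cov' ef' inf') => N /F'P[i [Q [g [Di gN gF]]]].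
exists Q, g; split=> //; rewrite gF; apply: alg_span_min; first exact: subalgebra_range.
by move=> a; apply: f'F'.
Qed.
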